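(* Let $c_0,c_1,c_2,\dots$ be formal (infinitesimal) variables and let $P(X)=\sum_{a\ge 0}c_aX^a$. Put $A(v,y)=v^{-1}P\bigl(v(1+y)^2\bigr)$ and define $$T(v,y)\;=\;y+\sum_{r=1}^\infty\frac1{r!}\Bigl(\frac1y\frac{d}{dy}\Bigr)^{r-1}\Bigl(\frac{1+y}{y}\,A(v,y)^r\Bigr)\;\in\;\mathbb{Q}[v^{\pm1},y^{\pm1}][[c_0,c_1,\dots]].$$ Then for every positive even integer $N$, $$\bigl[v^{N-1}y^{-2}\bigr]\biggl(\frac{T(v,y)-T(v,-y)}{2}\biggr)^{-N}\;=\;-\,\frac{(2N+1)!}{(N-1)!\,(N+1)!}\,c_N .$$
   Context: $[v^{m}y^{k}]F$ denotes the coefficient of $v^my^k$ in $F$; these coefficients are formal power series in the $c_a$. Since $\frac{T(v,y)-T(v,-y)}{2}=y\,(1+\varepsilon)$ with $\varepsilon$ in the ideal generated by the $c_a$, its $(-N)$-th power is defined as $y^{-N}(1+\varepsilon)^{-N}$ expanded as a power series in the $c_a$. The operator $\frac1y\frac{d}{dy}$ acts coefficientwise on Laurent polynomials in $y$. The statement also holds with $P$ a polynomial (only finitely many $c_a$ nonzero). *)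

(* Defs.v *)
(* Formal setting for
   Q[v^{+-1}, y^{+-1}][[c_0, c_1, ...]].
   - The Laurent polynomial ring Q[v^{+-1},y^{+-1}] is realised inside the
     field  LK := {fraction {poly {poly rat}}}  (outer variable = y,
     inner variable = v).
   - A formal power series in the countably many variables c_0, c_1, ...
     is a coefficient function  ser := seq nat -> LK, where a monomial
     c_{i_1} ... c_{i_d} is encoded by the SORTED (nondecreasing) list
     [:: i_1; ...; i_d]  (values on unsorted lists are irrelevant). *)
From HB Require Import structures.
From mathcomp Require Import all_boot all_order all_algebra.
Set Implicit Arguments.
Unset Strict Implicit.
Unset Printing Implicit Defensive.
Import Order.TTheory GRing.Theory Num.Theory.
Local Open Scope ring_scope.

Definition Rvy := {poly {poly rat}}.
Definition LK := {fraction Rvy}.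

Definition yL : LK := tofrac ('X : Rvy).
Definition vL : LK := tofrac (('X : {poly rat})%:P : Rvy).

Definition ddy (f : LK) : LK :=
  let r := repr f in
  tofrac ((\n_r)^`() * \d_r - \n_r * (\d_r)^`()) / tofrac (\d_r ^+ 2).

Definition theta (f : LK) : LK := yL^-1 * ddy f.

Definition negy (f : LK) : LK :=
  let r := repr f in
  tofrac (\n_r \Po (- 'X)) / tofrac (\d_r \Po (- 'X)).

Definition has_lcoef (f : LK) (m k : int) (x : rat) : Prop :=
  exists (a b : nat) (p : Rvy),
    f * (vL ^+ a * yL ^+ b) = tofrac p /\
    (0 <= m + a%:Z) /\ (0 <= k + b%:Z) /\
    (p`_(absz (k + b%:Z)))`_(absz (m + a%:Z)) = x.

Definition ser := seq nat -> LK.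

Fixpoint bitseqs (n : nat) : seq bitseq :=
  if n is n'.+1 then [seq b :: s | b <- [:: true; false], s <- bitseqs n']
  else [:: [::]].

Definition submons (mu : seq nat) : seq (seq nat) :=
  undup [seq mask m mu | m <- bitseqs (size mu)].
Definition mdiff (mu al : seq nat) : seq nat := foldr (fun x s => rem x s) mu al.

Definition sone : ser := fun mu => (mu == [::])%:R.
Definition sadd (f g : ser) : ser := fun mu => f mu + g mu.
Definition smul (f g : ser) : ser :=
  fun mu => \sum_(al <- submons mu) f al * g (mdiff mu al).
Definition spow (f : ser) (r : nat) : ser := iter r (smul f) sone.
Definition smap (h : LK -> LK) (f : ser) : ser := fun mu => h (f mu).

(* Sum of a family F_1, F_2, ... with F_r of order >= r in the c's
   (c-adic limit): the coefficient of a monomial of degree d only receives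
   contributions from r <= d. *)
Definition psum1 (F : nat -> ser) : ser :=
  fun mu => \sum_(1 <= r < (size mu).+1) F r mu.
Definition psum0 (F : nat -> ser) : ser :=
  fun mu => \sum_(0 <= r < (size mu).+1) F r mu.

Definition Aser : ser := fun mu =>
  if mu is [:: a] then vL ^+ a / vL * (1 + yL) ^+ (2 * a) else 0.

Definition Tser : ser :=
  sadd (fun mu => (mu == [::])%:R * yL)
       (psum1 (fun r mu => (r`!)%:R^-1 *
                iter r.-1 theta ((1 + yL) / yL * spow Aser r mu))).

Definition User : ser := fun mu => (Tser mu - negy (Tser mu)) / 2%:R.
Definition epsser : ser := fun mu => User mu / yL - (mu == [::])%:R.

(* ((T(v,y)-T(v,-y))/2)^{-N} := y^{-N} ((1+eps)^{-1})^N, with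
   (1+eps)^{-1} = sum_{k>=0} (-eps)^k *)
Definition inv1peps : ser := psum0 (fun k => spow (smap (fun x => - x) epsser) k).
Definition Xneg (N : nat) : ser := smap (fun x => yL ^- N * x) (spow inv1peps N).

(* Main.v *)
Require Import Defs.
From HB Require Import structures.
From mathcomp Require Import all_boot all_order all_algebra.
From mathcomp Require Import ring zify.
Import Order.TTheory GRing.Theory Num.Theory.
Local Open Scope ring_scope.

(* By Lagrange inversion T = Y + A(Y), where Y = y + O(c) solves Y^2 = y^2 + 2 A(Y) and
   A(Y) = v^-1 P(v (1 + Y)^2). Let Y' = Y(-y), s = 1 + (Y + Y')/2, e = (Y - Y')/2; then
   X = (T(y) - T(-y))/2 = s e. Put a = v s^2, b = v e^2, alpha = v (s + e)^2,
   beta = v (s - e)^2, D = (P(alpha) - P(beta))/(alpha - beta),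
   Pi = P(alpha) + P(beta) and W = v (1 - y^2). The equations of Y and Y' become
   s (1 - 2 D) = 1 and W = (a - b)(1 - 2 D) + W', where D, s and W' = Pi - 2 (a + b) D
   are symmetric in a and b. With [f,g] = v f_v g_y - v g_v f_y, whose residue always
   vanishes, the wanted coefficient is for N = 2 M the residue of
     y v^(1-N) X^-N = - (1/2) (a b)^-M [v,W]/v,
   and [v,W]/v = 4 [D,b] + [a,Pi]/a - [a,b]/a - 4 s [D,W'].
   The last term, divided by (a b)^M, is a combination of
   (a + b)^i (a b)^k [a + b, a b] with i >= 0, hence exact. The other terms are linear in
   the c_k and consist of the a^i b^j [a,b], which are exact unless i = j = -1; finally
   [a,b]/(a b) has residue 2, since its Euler derivative in the c's is exact. *)

Set Implicit Arguments.
Unset Strict Implicit.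
Unset Printing Implicit Defensive.

(** * Derivations and residues of brackets *)

(** The operator (1/y) d/dy is differentiation in y^2/2, and (1 + y)/y is what it makes of F(y) = y
    + y^2/2. So the series for T is Lagrange's formula for y + F(Y) - F(y), where Y^2/2 = y^2/2 +
    A(Y); this equals Y + A(Y). The variables a and b are suggested by (v X)^2 = a b: for N = 2 M
    the power (v X)^-N becomes the integral power (a b)^-M, and the coefficient becomes the residue
    of a 2-form. The obstacle is that this 2-form is not linear in the c_k, whereas the answer is.
    The nonlinear part is collected in s [D,W'], whose three ingredients are symmetric, and symmetry
    is what kills its residue. This needs s to be a polynomial in a + b, a b and the c_k; hence the
    passage to a quotient where D is nilpotent and s = 1/(1 - 2 D) is a finite geometric series. A
    given monomial in the c_k only sees such a quotient. The constant comes from the linear part: 4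
    [D,b] contributes N C(2N,N-1) and [a,Pi]/a contributes N C(2N,N), with sum N C(2N+1,N) =
    (2N+1)!/((N-1)! (N+1)!). *)

Definition derivation (R : comNzRingType) (D : R -> R) : Prop :=
  {morph D : x y / x + y} /\ forall x y, D (x * y) = D x * y + x * D y.

Section Derivation.
Variables (R : comNzRingType) (D : R -> R).
Hypothesis dD : derivation D.

Lemma derD x y : D (x + y) = D x + D y. Proof. exact: dD.1. Qed.
Lemma derM x y : D (x * y) = D x * y + x * D y. Proof. exact: dD.2. Qed.

Lemma der0 : D 0 = 0.
Proof. by apply: (addrI (D 0)); rewrite -derD !addr0. Qed.

Lemma derN x : D (- x) = - D x.
Proof. by apply: (addrI (D x)); rewrite -derD !subrr der0. Qed.

Lemma derB x y : D (x - y) = D x - D y.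
Proof. by rewrite derD derN. Qed.

Lemma der1 : D 1 = 0.
Proof. by apply: (addrI (D 1)); rewrite addr0 -[in RHS](mulr1 1) derM mulr1 mul1r. Qed.

Lemma der_natmul x n : D (x *+ n) = D x *+ n.
Proof. by elim: n => [|n IH]; rewrite ?mulr0n ?der0 // !mulrS derD IH. Qed.

Lemma der_nat n : D n%:R = 0.
Proof. by rewrite der_natmul der1 mul0rn. Qed.

Lemma derX x n : D (x ^+ n) = (x ^+ n.-1 * D x) *+ n.
Proof.
elim: n => [|n IH]; first by rewrite expr0 der1 mulr0n.
rewrite exprS derM IH mulrS mulrC; congr (_ + _) => /=.
by case: n {IH} => [|n]; rewrite ?mulr0n ?mulr0 //= mulrnAr mulrA -exprS.
Qed.

Lemma der_sum (I : Type) (r : seq I) (P : pred I) (F : I -> R) :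
  D (\sum_(i <- r | P i) F i) = \sum_(i <- r | P i) D (F i).
Proof. exact: (big_morph D derD der0). Qed.

Lemma der_inv x xi : x * xi = 1 -> D xi = - (xi ^+ 2 * D x).
Proof.
move=> e; have: D (x * xi) = 0 by rewrite e der1.
rewrite derM => h.
transitivity (xi * (D x * xi + x * D xi) - xi ^+ 2 * D x); last by rewrite h; ring.
ring: e.
Qed.
End Derivation.

Section Bracket.
Variables (R : comNzRingType) (G d : R -> R).
Hypotheses (dG : derivation G) (dd : derivation d).

(** With [G] = v d/dv and [d] = d/dy, this is the coefficient of the 2-form df dg with respect to
    (dv/v) dy. *)
Definition bracket f g := G f * d g - G g * d f.

Lemma bracket_derl g : derivation (bracket^~ g).
Proof.
by split=> x y /=; rewrite /bracket ?(derD dG) ?(derD dd) ?(derM dG) ?(derM dd); ring.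
Qed.

Lemma bracket_derr f : derivation (bracket f).
Proof.
by split=> x y /=; rewrite /bracket ?(derD dG) ?(derD dd) ?(derM dG) ?(derM dd); ring.
Qed.

Lemma bracketC f g : bracket g f = - bracket f g.
Proof. by rewrite /bracket; ring. Qed.

Lemma bracketxx f : bracket f f = 0.
Proof. by rewrite /bracket; ring. Qed.
End Bracket.

Lemma sum_even_odd (R : nmodType) (F : nat -> R) n :
  \sum_(j < (2 * n).+1) F j
  = \sum_(j < n.+1) F (2 * j)%N + \sum_(j < n) F (2 * j).+1.
Proof.
elim: n => [|n IH]; first by rewrite muln0 !big_ord_recr !big_ord0 /= addr0.
rewrite (_ : (2 * n.+1).+1 = (2 * n).+3) ?mulnS // 2!big_ord_recr IH /=.
rewrite [in RHS]big_ord_recr [X in _ = _ + X]big_ord_recr /= mulnS add2n.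
by rewrite -!addrA; congr (_ + _); rewrite [RHS]addrC -!addrA.
Qed.

(** * Exact 2-forms in an abstract ring with a notion of vanishing residue *)

Section Residue.
Variables (R : comNzRingType) (G dy E : R -> R).
Hypotheses (dG : derivation G) (ddy : derivation dy) (dE : derivation E).
Hypotheses (Gdy : forall x, G (dy x) = dy (G x)).
Hypotheses (EG : forall x, E (G x) = G (E x)) (Edy : forall x, E (dy x) = dy (E x)).
(** [lau] will mean that all c-coefficients are Laurent polynomials, [Zero] that all of them have
    residue 0. A vanishing predicate is enough: the one nonzero residue, that of [a,b]/(a b), is
    read off separately. *)
Variables (lau Zero : R -> Prop).
Hypotheses (lau1 : lau 1) (lauD : forall x y, lau x -> lau y -> lau (x + y))
  (lauN : forall x, lau x -> lau (- x))
  (lauM : forall x y, lau x -> lau y -> lau (x * y))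
  (lauG : forall x, lau x -> lau (G x)) (laudy : forall x, lau x -> lau (dy x))
  (lauE : forall x, lau x -> lau (E x)).
Hypotheses (ZeroD : forall x y, Zero x -> Zero y -> Zero (x + y))
  (ZeroN : forall x, Zero x -> Zero (- x))
  (Zero_natmul : forall x n, Zero (x *+ n.+1) -> Zero x)
  (ZeroG : forall x, lau x -> Zero (G x)) (Zerody : forall x, lau x -> Zero (dy x)).

Local Notation br := (bracket G dy).
Let brl g := bracket_derl dG ddy g.
Let brr f := bracket_derr dG ddy f.

Lemma lau0 : lau 0.
Proof. by rewrite -(subrr 1); auto. Qed.
Lemma lauX x n : lau x -> lau (x ^+ n).
Proof. by move=> h; elim: n => [|n IH] //; rewrite exprS; apply: lauM. Qed.
Lemma lau_natmul x n : lau x -> lau (x *+ n).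
Proof. by move=> h; elim: n => [|n IH]; [exact: lau0|rewrite mulrS; apply: lauD]. Qed.
Hint Resolve lau1 lauD lauN lauM lau0 lauX lau_natmul lauG laudy lauE : core.

Lemma Zero0 : Zero 0.
Proof. by rewrite -(der0 dG); apply: ZeroG. Qed.
Lemma ZeroB x y : Zero x -> Zero y -> Zero (x - y). Proof. by auto. Qed.
Lemma ZeroMn x n : Zero x -> Zero (x *+ n).
Proof. by move=> h; elim: n => [|n IH]; [exact: Zero0|rewrite mulrS; apply: ZeroD]. Qed.
Lemma Zero_sum n (F : nat -> R) :
  (forall i, (i < n)%N -> Zero (F i)) -> Zero (\sum_(i < n) F i).
Proof.
move=> h; elim/big_rec: _ => [|i x _ hx]; first exact: Zero0.
by apply: ZeroD hx; apply: h.
Qed.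

(** The bracket is a divergence, because the mixed second derivatives of [g] cancel. *)
Lemma Zero_bracket f g : lau f -> lau g -> Zero (br f g).
Proof.
move=> hf hg; rewrite (_ : br f g = G (f * dy g) - dy (f * G g)).
  by apply: ZeroB; auto.
by rewrite /bracket (derM dG) (derM ddy) Gdy; ring.
Qed.

Section Monomials.
Variables (a ai b bi : R).
Hypotheses (la : lau a) (lai : lau ai) (lb : lau b) (lbi : lau bi).
Hypotheses (aai : a * ai = 1) (bbi : b * bi = 1).

(** An integer exponent is encoded as a difference of naturals: [a] has exponent i - i', [b] has
    exponent j - j'. *)
Let mono i i' j j' := a ^+ i * ai ^+ i' * (b ^+ j * bi ^+ j') * br a b.

Lemma der_laurent (D : R -> R) x xi i i' : derivation D -> x * xi = 1 ->
  D (x ^+ i.+1 * xi ^+ i')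
  = x ^+ i * xi ^+ i' * D x *+ i.+1 - x ^+ i * xi ^+ i' * D x *+ i'.
Proof.
move=> dD e; rewrite (derM dD) !(derX dD) (der_inv dD e) /=.
rewrite mulrnAl mulrnAr; congr (_ + _); first by congr (_ *+ _); ring.
case: i' => [|i']; first by rewrite !mulr0n oppr0.
rewrite -mulNrn; congr (_ *+ _); rewrite /= !exprS.
move: (x ^+ i) (xi ^+ i') (D x) => u w z; ring: e.
Qed.

Lemma Zero_diffMn x p q : p <> q -> Zero (x *+ p - x *+ q) -> Zero x.
Proof.
move=> npq; case: (ltngtP p q) => // h.
  rewrite -opprB -mulrnBr 1?ltnW // -(subnSK h) => /ZeroN.
  by rewrite opprK; apply: Zero_natmul.
by rewrite -mulrnBr 1?ltnW // -(subnSK h); apply: Zero_natmul.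
Qed.

(** With p = i - i' and q = j - j', (p + 1) a^p b^q [a,b] = [a^(p+1) b^q, b], and p + 1 is not 0. *)
Lemma Zero_mono_a i i' j j' : i.+1 <> i' -> Zero (mono i i' j j').
Proof.
move=> ne; apply: (Zero_diffMn ne).
rewrite (_ : _ - _ = br (a ^+ i.+1 * ai ^+ i' * (b ^+ j * bi ^+ j')) b).
  by apply: Zero_bracket; auto 10.
have hb : br b b = 0 by exact: bracketxx.
have hbi : br bi b = 0 by rewrite (der_inv (brl b) bbi) hb; ring.
have hbj : br (b ^+ j * bi ^+ j') b = 0.
  by rewrite (derM (brl b)) !(derX (brl b)) hb hbi !mulr0 !mul0rn mulr0 mul0r addr0.
rewrite (derM (brl b)) hbj mulr0 addr0 (der_laurent i i' (brl b) aai) mulrBl.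
by rewrite !mulrnAl /mono; congr (_ *+ _ - _ *+ _); ring.
Qed.

Lemma Zero_mono_b i i' j j' : j.+1 <> j' -> Zero (mono i i' j j').
Proof.
move=> ne; apply: (Zero_diffMn ne).
rewrite (_ : _ - _ = br a (a ^+ i * ai ^+ i' * (b ^+ j.+1 * bi ^+ j'))).
  by apply: Zero_bracket; auto 10.
have ha : br a a = 0 by exact: bracketxx.
have hai : br a ai = 0 by rewrite (der_inv (brr a) aai) ha; ring.
have haj : br a (a ^+ i * ai ^+ i') = 0.
  by rewrite (derM (brr a)) !(derX (brr a)) ha hai !mulr0 !mul0rn mulr0 mul0r addr0.
rewrite (derM (brr a)) haj mul0r add0r (der_laurent j j' (brr a) bbi) mulrBr.
by rewrite !mulrnAr /mono; congr (_ *+ _ - _ *+ _); ring.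
Qed.

Lemma Zero_mono i i' j j' : ~~ ((i.+1 == i') && (j.+1 == j')) -> Zero (mono i i' j j').
Proof.
by rewrite negb_and => /orP[]/eqP; [exact: Zero_mono_a|exact: Zero_mono_b].
Qed.

(* In terms of the logarithmic derivatives, [E] of this 2-form is an exact form. *)
Lemma Zero_E_dlog : Zero (E (ai * bi * br a b)).
Proof.
pose aE := ai * E a; pose bE := bi * E b.
pose aG := ai * G a; pose bG := bi * G b; pose ay := ai * dy a; pose by_ := bi * dy b.
(* The form is dlog a dlog b; since dlog forms are closed, its [E]-derivative is d((E a / a) dlog b)
   - d((E b / b) dlog a). *)
rewrite (_ : E _ = (G (aE * by_) - dy (aE * bG)) - (G (bE * ay) - dy (bE * aG))).
  by rewrite /aE /bE /aG /bG /ay /by_; apply: ZeroB; apply: ZeroB; auto 10.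
rewrite /bracket /aE /bE /aG /bG /ay /by_.
rewrite !(derB dE, derM dE, derM dG, derM ddy) !EG !Edy !Gdy.
rewrite (der_inv dE aai) (der_inv dE bbi) (der_inv dG aai) (der_inv dG bbi).
rewrite (der_inv ddy aai) (der_inv ddy bbi).
ring.
Qed.
End Monomials.

Section Symmetric.
Variables (c : nat -> R) (e1 e2 e2i : R) (M : nat).
Hypotheses (Gc : forall k, G (c k) = 0) (dyc : forall k, dy (c k) = 0).
Hypothesis (Zeroc : forall k x, Zero x -> Zero (c k * x)).
Hypotheses (le1 : lau e1) (le2 : lau e2) (le2i : lau e2i) (e2e2i : e2 * e2i = 1).

Inductive sym : R -> Prop :=
| sym1 : sym 1
| symc k : sym (c k)
| syme1 : sym e1
| syme2 : sym e2
| symD f g : sym f -> sym g -> sym (f + g)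
| symN f : sym f -> sym (- f)
| symM f g : sym f -> sym g -> sym (f * g).
Hint Resolve sym1 symc syme1 syme2 symD symN symM : core.

Lemma sym0 : sym 0. Proof. by rewrite -(subrr 1); auto. Qed.
Lemma symMn f n : sym f -> sym (f *+ n).
Proof. by move=> h; elim: n => [|n IH]; [exact: sym0|rewrite mulrS; auto]. Qed.
Lemma symX f n : sym f -> sym (f ^+ n).
Proof. by move=> h; elim: n => [|n IH] //; rewrite exprS; auto. Qed.
Lemma sym_sum n (F : nat -> R) : (forall i, sym (F i)) -> sym (\sum_(i < n) F i).
Proof.
by move=> h; elim/big_rec: _ => [|i x _ hx]; [exact: sym0|apply: symD].
Qed.

Lemma der_sym (D : R -> R) K : derivation D -> (forall k, D (c k) = 0) ->
  (exists2 Q, sym Q & D e1 = Q * K) -> (exists2 Q, sym Q & D e2 = Q * K) ->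
  forall f, sym f -> exists2 Q, sym Q & D f = Q * K.
Proof.
move=> dD Dc h1 h2 f; elim=> {f} // [|k|f g _ [Q hQ eQ] _ [Q' hQ' eQ']
  |f _ [Q hQ eQ]|f g hf [Q hQ eQ] hg [Q' hQ' eQ']].
- by exists 0; [exact: sym0|rewrite (der1 dD) mul0r].
- by exists 0; [exact: sym0|rewrite Dc mul0r].
- by exists (Q + Q'); [auto|rewrite (derD dD) eQ eQ' mulrDl].
- by exists (- Q); [auto|rewrite (derN dD) eQ mulNr].
- by exists (Q * g + f * Q'); [auto|rewrite (derM dD) eQ eQ'; ring].
Qed.

(** Chain rule: [Q] is the Jacobian of (f, g) with respect to (e1, e2), the [c k] being constants of
    both derivations. *)
Lemma bracket_sym f g : sym f -> sym g -> exists2 Q, sym Q & br f g = Q * br e1 e2.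
Proof.
move=> hf hg.
have brc h k : br h (c k) = 0 by rewrite /bracket Gc dyc !mulr0 mul0r subr0.
have brc' h k : br (c k) h = 0 by rewrite bracketC brc oppr0.
have z : exists2 Q, sym Q & 0 = Q * br e1 e2 by exists 0; [exact: sym0|rewrite mul0r].
apply: (der_sym (brr f)) hg => //.
- apply: (der_sym (brl e1)) hf => //; first by rewrite bracketxx.
  by exists (- 1); [auto|rewrite bracketC mulN1r].
- apply: (der_sym (brl e2)) hf => //; last by rewrite bracketxx.
  by exists 1; [auto|rewrite mul1r].
Qed.

(* Any [e1^i e2^k [e1,e2]] with [i >= 0] is exact, whatever the sign of [k]. *)
Lemma Zero_sym_bracket f g h : sym f -> sym g -> sym h ->
  Zero (e2i ^+ M * (f * br g h)).
Proof.
move=> hf hg hh; have [Q hQ ->] := bracket_sym hg hh.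
(* Multiplication by [e1] or [e2] only shifts [i] or [j], so quantifying over both makes the
   property stable under multiplication by symmetric elements. *)
pose Zer x := forall i j, Zero (e1 ^+ i * e2 ^+ j * e2i ^+ M * x).
have ZerK k : sym k -> forall x, Zer x -> Zer (k * x).
  elim=> {k} [|k|||k k' _ IH _ IH'|k _ IH|k k' _ IH _ IH'] x hx.
  - by rewrite mul1r.
  - by move=> i j; rewrite mulrCA; apply: Zeroc.
  - by move=> i j; have := hx i.+1 j; rewrite exprS; congr Zero; ring.
  - by move=> i j; have := hx i j.+1; rewrite exprS; congr Zero; ring.
  - by move=> i j; rewrite mulrDl mulrDr; apply: ZeroD; [exact: IH|exact: IH'].
  - by move=> i j; rewrite mulNr mulrN; apply: ZeroN; exact: IH.
  - by rewrite -mulrA; apply: IH; apply: IH'.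
have Zer_base : Zer (br e1 e2).
  (* (i + 1) e1^i e2^(j-M) [e1,e2] = [e1^(i+1) e2^(j-M), e2], and i + 1 is never 0, whatever the
     sign of j - M. *)
  move=> i j; apply: (Zero_natmul (n := i)).
  rewrite (_ : _ *+ _ = br (e1 ^+ i.+1 * (e2 ^+ j * e2i ^+ M)) e2).
    by apply: Zero_bracket; auto 10.
  have h2 : br e2 e2 = 0 by exact: bracketxx.
  have h2i : br e2i e2 = 0 by rewrite (der_inv (brl e2) e2e2i) h2; ring.
  rewrite (derM (brl e2)) (derM (brl e2) (e2 ^+ j)) !(derX (brl e2)) h2 h2i.
  rewrite !mulr0 !mul0rn !(mulr0, mul0r, addr0, add0r) mulrnAl /=.
  by congr (_ *+ _); ring.
have := ZerK _ (symM hf hQ) _ Zer_base 0%N 0%N.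
by rewrite !expr0 !mul1r -(mulrA f).
Qed.
End Symmetric.

(** * The 2-form of the wanted coefficient and its residue *)

Section Core.
(** Here [d] is the half difference written e in the overview, [I] is the inverse of X = s d, and
    [q4] is 1/4. *)
Variables (n M : nat) (c : nat -> R) (y v vi s d I q4 : R).
Hypotheses (Gc : forall k, G (c k) = 0) (dyc : forall k, dy (c k) = 0).
Hypothesis (Zeroc : forall k x, Zero x -> Zero (c k * x)).
Hypothesis (nilc : forall f : nat -> R, exists K, (\sum_(k < n) c k * f k) ^+ K = 0).
Hypotheses (lv : lau v) (lvi : lau vi) (ls : lau s) (ld : lau d)
  (lI : lau I) (lq4 : lau q4) (lc : forall k, lau (c k)).
Hypotheses (vvi : v * vi = 1) (Isd : I * s * d = 1) (q44 : q4 * 4%:R = 1).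
Hypotheses (Gv : G v = v) (dyv : dy v = 0) (dyy : dy y = 1).
Let Pf x := \sum_(k < n) c k * x ^+ k.
Let al := v * (s + d) ^+ 2.
Let be := v * (s - d) ^+ 2.
Hypothesis Hp : (s + d - 1) ^+ 2 = y ^+ 2 + 2%:R * vi * Pf al.
Hypothesis Hq : (s - d - 1) ^+ 2 = y ^+ 2 + 2%:R * vi * Pf be.
Hypotheses (M0 : (0 < M)%N) (Mn : (2 * M < n)%N).
Let N := (2 * M)%N.
Let a := v * s ^+ 2.
Let b := v * d ^+ 2.
(** This is 1/(al - be), since al - be = 4 v s d. *)
Let gam := q4 * vi * I.
Let h k := gam * (al ^+ k - be ^+ k).
Let D := \sum_(k < n) c k * h k.
Let r := 1 - 2%:R * D.
Let ai := vi * r ^+ 2.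
Let bi := vi * (I * s) ^+ 2.
Let Pi := Pf al + Pf be.

Let D_E : D = gam * (Pf al - Pf be).
Proof. by rewrite -sumrB big_distrr; apply: eq_bigr => k _ /=; rewrite /h; ring. Qed.

(** The difference of [Hp] and [Hq] reads 4 d (s - 1) = 2 (Pf al - Pf be)/v = 8 s d D; division by 4
    d gives s - 1 = 2 s D. *)
Let sr : s * r = 1.
Proof.
rewrite /r D_E /gam.
have e : 4%:R * s * d - 4%:R * d = 2%:R * vi * (Pf al - Pf be).
  transitivity ((s + d - 1) ^+ 2 - (s - d - 1) ^+ 2); first by ring.
  by rewrite Hp Hq; ring.
transitivity (s - s * q4 * I * (2%:R * vi * (Pf al - Pf be))); first by ring.
rewrite -e; transitivity (s - (q4 * 4%:R) * (I * s * d) * s + (q4 * 4%:R) * (I * s * d)).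
  by ring.
by rewrite q44 Isd; ring.
Qed.

Let aai : a * ai = 1.
Proof.
rewrite /a /ai (_ : _ * _ = (v * vi) * (s * r) ^+ 2); last by ring.
by rewrite vvi sr; ring.
Qed.

Let bbi : b * bi = 1.
Proof.
rewrite /b /bi (_ : _ * _ = (v * vi) * (I * s * d) ^+ 2); last by ring.
by rewrite vvi Isd; ring.
Qed.

Let lPf x : lau x -> lau (Pf x).
Proof. by move=> hx; rewrite /Pf; elim/big_rec: _ => *; auto. Qed.

Let lr : lau r.
Proof.
have hal : lau al by rewrite /al; auto.
have hbe : lau be by rewrite /be; auto 10.
by rewrite /r D_E /gam; auto 20.
Qed.

Let la : lau a. Proof. by rewrite /a; auto. Qed.
Let lb : lau b. Proof. by rewrite /b; auto. Qed.
Let lai : lau ai. Proof. by rewrite /ai; auto. Qed.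
Let lbi : lau bi. Proof. by rewrite /bi; auto. Qed.

Let gamK : gam * (al - be) = 1.
Proof.
rewrite /gam /al /be (_ : _ * _ = (q4 * 4%:R) * (v * vi) * (I * s * d)); last by ring.
by rewrite q44 vvi Isd !mulr1.
Qed.

Let e1 := a + b.
Let e2 := a * b.
Let S := sym c e1 e2.

Let S_alD : S (al + be).
Proof.
rewrite (_ : al + be = e1 *+ 2); first by apply: symMn; exact: syme1.
by rewrite /al /be /e1 /a /b; ring.
Qed.

Let S_alM : S (al * be).
Proof.
rewrite (_ : al * be = e1 * e1 - e2 *+ 4).
  by apply: symD; [apply: symM|apply: symN; apply: symMn]; constructor.
by rewrite /al /be /e1 /e2 /a /b; ring.
Qed.

(** The difference quotients satisfy the linear recurrence with coefficients al + be = 2 e1 and -al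
    be = -(e1^2 - 4 e2), starting from 0 and 1. The recurrence avoids dividing by al - be, which is
    not symmetric. *)
Let S_h k : S (h k).
Proof.
have [//] : S (h k) /\ S (h k.+1).
elim: k => [|k [h0 h1]]; rewrite /h.
  by rewrite !expr0 subrr mulr0 !expr1 gamK; split; [exact: sym0|exact: sym1].
split=> //; rewrite (_ : _ * _ = (al + be) * h k.+1 - (al * be) * h k).
  by apply: symD; [apply: symM|apply: symN; apply: symM].
by rewrite /h !exprS; ring.
Qed.

Let S_pow k : S (al ^+ k + be ^+ k).
Proof.
have [//] : S (al ^+ k + be ^+ k) /\ S (al ^+ k.+1 + be ^+ k.+1).
elim: k => [|k [h0 h1]].
  by rewrite !expr0 !expr1; split=> //; apply: symD; exact: sym1.
split=> //; rewrite (_ : _ + _ = (al + be) * (al ^+ k.+1 + be ^+ k.+1)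
  - (al * be) * (al ^+ k + be ^+ k)).
  by apply: symD; [apply: symM|apply: symN; apply: symM].
by rewrite !exprS; ring.
Qed.

Let S_D : S D.
Proof.
apply: (@sym_sum _ _ _ n (fun k => c k * h k)) => k.
by apply: symM; [exact: symc|exact: S_h].
Qed.

Let PiE : Pi = \sum_(k < n) c k * (al ^+ k + be ^+ k).
Proof. by rewrite /Pi -big_split; apply: eq_bigr => k _ /=; ring. Qed.

Let S_Pi : S Pi.
Proof.
rewrite PiE; apply: (@sym_sum _ _ _ n (fun k => c k * (al ^+ k + be ^+ k))) => k.
by apply: symM; [exact: symc|exact: S_pow].
Qed.

(* [s] is the geometric series of the nilpotent element [2 D]. *)
Let S_s : S s.
Proof.
have S2D : S (2%:R * D) by rewrite mulr_natl; apply: symMn.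
have [K hK] : exists K, (2%:R * D) ^+ K = 0.
  by have [K hK] := nilc h; exists K; rewrite exprMn hK mulr0.
have := subrX1 (2%:R * D) K; rewrite hK sub0r => e.
have -> : s = \sum_(i < K) (2%:R * D) ^+ i.
  set sum := \sum_(i < K) _ in e *; transitivity (s * (r * sum)).
    by rewrite /r -[1 - _]opprB mulNr -e opprK mulr1.
  by rewrite mulrA sr mul1r.
by apply: (@sym_sum _ _ _ K (fun k => (2%:R * D) ^+ k)) => k; exact: symX.
Qed.

Let W := v * (1 - y ^+ 2).
Let Wp := Pi - 2%:R * e1 * D.

(** This is the sum of [Hp] and [Hq], with v s rewritten as a r. *)
Let W_E : W = 2%:R * (a * r) - e1 + Pi.
Proof.
have e : 4%:R * W = 4%:R * (2%:R * (a * r) - e1 + Pi).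
  transitivity (v *+ 4 - 2%:R * v * ((s + d - 1) ^+ 2 + (s - d - 1) ^+ 2)
    + 4%:R * (v * vi) * Pi).
    by rewrite Hp Hq /W /Pi; ring.
  rewrite vvi (_ : a * r = v * s * (s * r)); last by rewrite /a; ring.
  by rewrite sr /e1 /a /b; ring.
by move/(congr1 ( *%R q4)): e; rewrite [LHS]mulrA [RHS]mulrA q44 !mul1r.
Qed.

Let W_E' : W = (a - b) * r + Wp.
Proof. by rewrite W_E /Wp /r /e1; ring. Qed.

(** Substituting v = a r^2 splits [v,W]/v into [a,W]/a - 4 s [D,W]. The form [W_E] serves the first
    bracket and [W_E'] the second; with s r = 1 the terms in [a,D] then cancel, and only [D,b]
    survives from the non-symmetric part a - b of [W_E']. *)
Let core_bracket :
  2%:R * (y * v) = - (4%:R * br D b + ai * br a Pi - ai * br a b - 4%:R * (s * br D Wp)).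
Proof.
have -> : 2%:R * (y * v) = - (vi * br v W).
  transitivity ((v * vi) * 2%:R * (y * v)); first by rewrite vvi mul1r.
  rewrite /bracket Gv dyv mulr0 subr0 /W (derM ddy) dyv (derB ddy) (der1 ddy).
  by rewrite (derX ddy) dyy; ring.
congr (- _).
have dr g : br r g = - 2%:R * br D g.
  rewrite /r (derB (brl g)) (der1 (brl g)) (derM (brl g)) (der_nat (brl g)).
  by ring.
have rd g : br g r = - 2%:R * br g D by rewrite bracketC dr [br D g]bracketC; ring.
have vE : v = a * r ^+ 2.
  by rewrite /a (_ : _ * _ * _ = v * (s * r) ^+ 2); [rewrite sr; ring|ring].
have viE : vi = ai * s ^+ 2.
  by rewrite /ai (_ : _ * _ * _ = vi * (s * r) ^+ 2); [rewrite sr; ring|ring].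
have -> : br v W = r ^+ 2 * br a W - 4%:R * (a * r) * br D W.
  by rewrite [in LHS]vE (derM (brl W)) (derX (brl W)) dr /=; ring.
have -> : vi * (r ^+ 2 * br a W - 4%:R * (a * r) * br D W)
   = ai * br a W - 4%:R * s * br D W.
  rewrite viE; transitivity ((s * r) ^+ 2 * ai * br a W
    - 4%:R * (a * ai) * (s * r) * s * br D W); first by ring.
  by rewrite sr aai; ring.
have -> : br D W = r * (br D a - br D b) + br D Wp.
  rewrite W_E' (derD (brr D)) (derM (brr D)) rd bracketxx (derB (brr D)); ring.
have -> : br a W = - 4%:R * (a * br a D) - br a b + br a Pi.
  rewrite W_E (derD (brr a)) (derB (brr a)) (derM (brr a) 2%:R) (derM (brr a) a).
  by rewrite (derD (brr a) a b) rd !bracketxx (der_nat (brr a)); ring.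
transitivity (- 4%:R * (a * ai) * br a D - ai * br a b + ai * br a Pi
 - 4%:R * (s * r) * (br D a - br D b) - 4%:R * s * br D Wp); first by ring.
by rewrite aai sr [br D a]bracketC; ring.
Qed.

Let alX k : al ^+ k = \sum_(j < (2 * k).+1) v ^+ k * (s ^+ (2 * k - j) * d ^+ j) *+ 'C(2 * k, j).
Proof.
rewrite /al exprMn -exprM exprDn big_distrr; apply: eq_bigr => j _ /=.
by rewrite mulrnAr.
Qed.

Let beX k : be ^+ k =
  \sum_(j < (2 * k).+1) v ^+ k * ((- 1) ^+ j * (s ^+ (2 * k - j) * d ^+ j)) *+ 'C(2 * k, j).
Proof.
rewrite /be exprMn -exprM exprBn big_distrr; apply: eq_bigr => j _ /=.
by rewrite mulrnAr !mulrA.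
Qed.

Let pow_even k j : (j <= k)%N ->
  v ^+ k * (s ^+ (2 * k - 2 * j) * d ^+ (2 * j)) = a ^+ (k - j) * b ^+ j.
Proof.
move=> jk; rewrite /a /b -mulnBr (exprMn _ v) (exprMn _ v) -!exprM -{1}(subnK jk) exprD.
ring.
Qed.

(** Only the even powers of [d] survive in the sum, and these give monomials in [a] and [b]. *)
Let powD_E k : al ^+ k + be ^+ k
  = \sum_(j < k.+1) (a ^+ (k - j) * b ^+ j) *+ (2 * 'C(2 * k, 2 * j)).
Proof.
rewrite alX beX -big_split /=.
rewrite (@sum_even_odd _ (fun j => v ^+ k * (s ^+ (2 * k - j) * d ^+ j) *+ 'C(2 * k, j) +
 v ^+ k * ((-1) ^+ j * (s ^+ (2 * k - j) * d ^+ j)) *+ 'C(2 * k, j))).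
rewrite [X in _ + X]big1 ?addr0 => [|j _]; last first.
  by rewrite -signr_odd /= oddM expr1 mulN1r mulrN mulNrn subrr.
apply: eq_bigr => j _; rewrite -signr_odd oddM expr0 mul1r pow_even ?leq_ord //.
by rewrite -mulrnDr addnn -mul2n.
Qed.

(** Only the odd powers of [d] survive, each twice; division by 4 v s d leaves a factor 1/2, which
    the doubling clears. *)
Let h_E k : h k *+ 2 = \sum_(j < k) (a ^+ (k.-1 - j) * b ^+ j) *+ 'C(2 * k, (2 * j).+1).
Proof.
rewrite /h alX beX -sumrB /=.
rewrite (@sum_even_odd _ (fun j => v ^+ k * (s ^+ (2 * k - j) * d ^+ j) *+ 'C(2 * k, j) -
 v ^+ k * ((-1) ^+ j * (s ^+ (2 * k - j) * d ^+ j)) *+ 'C(2 * k, j))).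
rewrite [X in X + _]big1 ?add0r => [|j _]; last first.
  by rewrite -signr_odd oddM expr0 mul1r subrr.
rewrite -mulrnAr -sumrMnl big_distrr; apply: eq_bigr => j _ /=.
rewrite -signr_odd /= oddM expr1 mulN1r mulrN mulNrn opprK.
rewrite -mulrnDl mulrnAC mulrnAr -[in RHS]mulr_natl -[in LHS]mulr_natl; congr (_ * _).
have e : v ^+ k * (s ^+ (2 * k - (2 * j).+1) * d ^+ (2 * j).+1)
   = v * s * d * (a ^+ (k.-1 - j) * b ^+ j).
  have jk : (j <= k.-1)%N by have := ltn_ord j; lia.
  rewrite -pow_even // (_ : (2 * k - (2 * j).+1 = (2 * k.-1 - 2 * j).+1)%N); last first.
    by have := ltn_ord j; lia.
  have ek : v ^+ k = v * v ^+ k.-1.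
    by rewrite -exprS prednK // (leq_ltn_trans (leq0n j) (ltn_ord j)).
  by rewrite ek (exprS s) (exprS d); ring.
rewrite e /gam; transitivity ((q4 * 4%:R) * (v * vi) * (I * s * d) * (a ^+ (k.-1 - j) * b ^+ j)).
  by ring.
by rewrite q44 vvi Isd !mul1r.
Qed.

Let u := ai ^+ M * bi ^+ M.
Let w := ai * bi * br a b.

Lemma Zero_sum_single m j0 (F : nat -> R) : (j0 < m)%N ->
  (forall j, (j < m)%N -> j != j0 -> Zero (F j)) ->
  Zero (\sum_(j < m) F j - F j0).
Proof.
move=> hj0 hF; rewrite (bigD1 (Ordinal hj0)) //= addrAC subrr add0r.
elim/big_rec: _ => [|j x hj hx]; first exact: Zero0.
by apply: ZeroD hx; apply: hF.
Qed.

Let br_monob i j : br (a ^+ i * b ^+ j) b = a ^+ i.-1 * b ^+ j * br a b *+ i.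
Proof.
rewrite (derM (brl b)) !(derX (brl b)) bracketxx !mulr0 mul0rn mulr0 addr0.
by rewrite mulrnAl; congr (_ *+ _); rewrite mulrAC.
Qed.

Let br_monoa i j : br a (a ^+ i * b ^+ j) = a ^+ i * b ^+ j.-1 * br a b *+ j.
Proof.
rewrite (derM (brr a)) !(derX (brr a)) bracketxx !mulr0 mul0rn mul0r add0r.
by rewrite mulrnAr; congr (_ *+ _); rewrite mulrA.
Qed.

Let mono i i' j j' := a ^+ i * ai ^+ i' * (b ^+ j * bi ^+ j') * br a b.

Let Zmono i i' j j' : ~~ ((i.+1 == i') && (j.+1 == j')) -> Zero (mono i i' j j').
Proof. exact: Zero_mono. Qed.

Let mono_w i j : mono i i.+1 j j.+1 = w.
Proof.
rewrite /mono !exprS /w; transitivity ((a * ai) ^+ i * (b * bi) ^+ j * (ai * bi * br a b)).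
  by rewrite !exprMn; ring.
by rewrite aai bbi !expr1n !mul1r.
Qed.

(** The monomials are a^(k-2-j-M) b^(j-M). Both exponents are -1 only for j = M - 1 and k = 2 M = N,
    where the coefficient is 2 (N - M) C(2N,N-1). *)
Let lin1 k : Zero (u * (4%:R * br (h k) b) - w *+ (if k == N then N * 'C(2 * N, N.-1) else 0)%N).
Proof.
pose F j := mono (k.-1 - j).-1 M j M *+ (2 * 'C(2 * k, (2 * j).+1) * (k.-1 - j)).
have -> : u * (4%:R * br (h k) b) = \sum_(j < k) F j.
  rewrite (_ : 4%:R * br (h k) b = br (h k *+ 2) b *+ 2); last first.
    by rewrite (der_natmul (brl b)); ring.
  rewrite h_E (der_sum (brl b)) -sumrMnl big_distrr; apply: eq_bigr => j _ /=.
  rewrite (der_natmul (brl b)) br_monob -!mulrnA mulrnAr /F /mono /u.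
  rewrite [(_ * (_ * 2))%N]mulnC [(_ * 2)%N]mulnC; congr (_ *+ _); ring.
have ZF j : ~~ ((k == N) && (j == M.-1)) -> Zero (F j).
  move=> hj; rewrite /F; case: (posnP (k.-1 - j)) => [->|kj].
    by rewrite muln0 mulr0n; exact: Zero0.
  by apply: ZeroMn; apply: Zmono; apply: contra hj; rewrite /N; lia.
case: eqP => [kN|/eqP kN]; last first.
  rewrite mulr0n subr0; apply: (@Zero_sum k F) => j _.
  by apply: ZF; rewrite (negbTE kN).
have Mk : (M.-1 < k)%N by rewrite kN /N; lia.
have -> : w *+ (N * 'C(2 * N, N.-1)) = F M.-1.
  rewrite /F kN (_ : (N.-1 - M.-1).-1 = M.-1); last by rewrite /N; lia.
  rewrite (_ : mono _ _ _ _ = w); last by rewrite -{2 4}(prednK M0) mono_w.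
  rewrite (_ : (2 * M.-1).+1 = N.-1); last by rewrite /N; lia.
  by congr (_ *+ _); rewrite mulnAC; congr (_ * _)%N; rewrite /N; lia.
by apply: Zero_sum_single => // j _ hj; apply: ZF; rewrite (negbTE hj) andbF.
Qed.

(** The monomials are a^(k-j-M-1) b^(j-1-M). Both exponents are -1 only for j = M and k = 2 M = N,
    where the coefficient is 2 M C(2N,N). *)
Let lin2 k : Zero (u * (ai * br a (al ^+ k + be ^+ k))
  - w *+ (if k == N then N * 'C(2 * N, N) else 0)%N).
Proof.
pose F j := mono (k - j) M.+1 j.-1 M *+ (2 * 'C(2 * k, 2 * j) * j).
have -> : u * (ai * br a (al ^+ k + be ^+ k)) = \sum_(j < k.+1) F j.
  rewrite powD_E (der_sum (brr a)) !big_distrr; apply: eq_bigr => j _ /=.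
  rewrite (der_natmul (brr a)) br_monoa -!mulrnA !mulrnAr /F /mono /u [(j * _)%N]mulnC.
  by congr (_ *+ _); rewrite exprS; ring.
have ZF j : ~~ ((k == N) && (j == M)) -> (j <= k)%N -> Zero (F j).
  move=> hj jk; rewrite /F; case: (posnP j) => [->|j0].
    by rewrite muln0 mulr0n; exact: Zero0.
  by apply: ZeroMn; apply: Zmono; apply: contra hj; rewrite /N; lia.
case: eqP => [kN|/eqP kN]; last first.
  rewrite mulr0n subr0; apply: (@Zero_sum k.+1 F) => j hj.
  by apply: ZF => //; rewrite (negbTE kN).
have Mk : (M < k.+1)%N by rewrite kN /N; lia.
have -> : w *+ (N * 'C(2 * N, N)) = F M.
  rewrite /F kN (_ : (N - M)%N = M); last by rewrite /N; lia.
  rewrite (_ : mono _ _ _ _ = w); last by rewrite -{4}(prednK M0) mono_w.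
  by congr (_ *+ _); rewrite -/N mulnAC.
by apply: Zero_sum_single => // j jk hj; apply: ZF => //; rewrite (negbTE hj) andbF.
Qed.

(** Here the parity of [N] enters: only the square of 1/(v s d) is a monomial in [ai] and [bi]. *)
Let uE : (vi * I) ^+ N = u.
Proof.
rewrite /u -exprMn /N exprM; congr (_ ^+ _).
rewrite /ai /bi (_ : _ * _ * _ = (vi * I) ^+ 2 * (s * r) ^+ 2); last by ring.
by rewrite sr; ring.
Qed.

(** The exponent of [a] is -M - 1, which differs from -1 because M > 0. *)
Let Zero_uab : Zero (u * (ai * br a b)).
Proof.
have : Zero (mono 0 M.+1 0 M) by apply: Zmono; lia.
by rewrite /mono !expr0 /u exprS; congr Zero; ring.
Qed.

(** The inverses are exported so that the constant term of [w] can be computed from them;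
    [Zero (E w)] says that the residue of [w] does not depend on the c's. *)
Lemma residue_core : exists ai bi : R, let w := ai * bi * br a b in
  [/\ a * ai = 1, b * bi = 1, Zero (E w) &
   Zero (2%:R * (y * v * (vi * I) ^+ N) + c N * w *+ (N * 'C((2 * N).+1, N)))].
Proof.
exists ai, bi; split; [exact: aai|exact: bbi|exact: Zero_E_dlog|rewrite -/w].
rewrite uE mulrA core_bracket.
set C1 := (N * 'C(2 * N, N.-1))%N; set C2 := (N * 'C(2 * N, N))%N.
(* Pascal's rule merges the contributions of 4 [D,b] and [a,Pi]/a. *)
have -> : (N * 'C((2 * N).+1, N) = C1 + C2)%N.
  by rewrite /C1 /C2 -mulnDr -[X in 'C(_.+1, X)](prednK (n := N)) ?binS ?prednK 1?addnC // /N; lia.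
pose F k := c k * (u * (4%:R * br (h k) b) - w *+ (if k == N then C1 else 0)%N)
  + c k * (u * (ai * br a (al ^+ k + be ^+ k)) - w *+ (if k == N then C2 else 0)%N).
have ZF : Zero (\sum_(k < n) F k).
  by apply: (@Zero_sum n F) => k _; apply: ZeroD; apply: Zeroc; [exact: lin1|exact: lin2].
have eF : \sum_(k < n) F k = u * (4%:R * br D b) + u * (ai * br a Pi)
   - c N * w *+ (C1 + C2).
  pose H k := c k * w *+ (if k == N then C1 + C2 else 0)%N.
  have -> : c N * w *+ (C1 + C2) = \sum_(k < n) H k.
    rewrite (bigD1 (Ordinal Mn)) //= big1 ?addr0 => [|k /eqP kN].
      by rewrite /H eqxx.
    by rewrite /H ifN ?mulr0n //; apply/eqP => e; apply: kN; apply: val_inj.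
  have brc x k : br x (c k) = 0 by rewrite /bracket Gc dyc !mulr0 mul0r subr0.
  have brc' x k : br (c k) x = 0 by rewrite bracketC brc oppr0.
  rewrite PiE (der_sum (brl b)) (der_sum (brr a)) !big_distrr -big_split -sumrB.
  apply: eq_bigr => k _ /=; rewrite /F /H.
  rewrite (derM (brl b)) (derM (brr a)) brc brc'.
  by case: eqP => _; rewrite ?mulr0n ?mulrnDr; ring.
have Zs : Zero (u * (s * br D Wp)).
  have -> : u = (ai * bi) ^+ M by rewrite exprMn.
  apply: (@Zero_sym_bracket c e1 e2) => //.
  - by rewrite /e1; auto.
  - by rewrite /e2; auto.
  - by auto.
  - by rewrite /e2 mulrACA aai bbi mul1r.
  - apply: symD; first exact: S_Pi.
    by apply: symN; rewrite -mulrA mulr_natl; apply: symMn; apply: symM; [exact: syme1|exact: S_D].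
have := ZeroD (ZeroN ZF) (ZeroD Zero_uab (ZeroMn 4 Zs)).
by rewrite eF; congr Zero; ring.
Qed.
End Core.
End Residue.

(** * Derivations and residues of rational functions *)

Section Fractions.
Variable A : idomainType.
Implicit Types f g : {fraction A}.
Local Notation "x %:F" := (@tofrac A x).

Lemma frac_numden f : f = (\n_(repr f))%:F / (\d_(repr f))%:F.
Proof.
rewrite -[LHS]reprK; move: (repr f) => x.
apply: (canRL (mulfK _)); first by rewrite tofrac_eq0 denom_ratioP.
rewrite !piE; apply/eqmodP => /=; rewrite FracField.equivfE.
by rewrite /FracField.mulf !numden_Ratio ?(oner_neq0, mulf_neq0, denom_ratioP) // !mulr1 mulrC.
Qed.

Lemma frac_eqP (a b a' b' : A) : b != 0 -> b' != 0 ->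
  a%:F / b%:F = a'%:F / b'%:F <-> a * b' = a' * b.
Proof.
move=> b0 b0'; have e : (a%:F / b%:F == a'%:F / b'%:F) = (a * b' == a' * b).
  by rewrite eqr_div ?tofrac_eq0 // -!tofracM tofrac_eq.
by split=> [/eqP|/eqP h]; [rewrite e => /eqP|apply/eqP; rewrite e].
Qed.

Section FracDer.
Variable D : A -> A.
Hypothesis dD : derivation D.

Definition frac_der f : {fraction A} :=
  let r := repr f in (D \n_r * \d_r - \n_r * D \d_r)%:F / (\d_r ^+ 2)%:F.

(** The quotient rule is independent of the chosen representative: if a d = n b, the two results
    differ by a combination of a d - n b and its derivative. *)
Lemma frac_der_div (a b : A) : b != 0 ->
  frac_der (a%:F / b%:F) = (D a * b - a * D b)%:F / (b ^+ 2)%:F.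
Proof.
move=> b0; rewrite /frac_der; set f := a%:F / b%:F.
have := frac_numden f; rewrite {1}/f; have := denom_ratioP (repr f).
move: (\n_(repr f)) (\d_(repr f)) => n d d0 /(frac_eqP _ _ b0 d0) e.
apply/frac_eqP; rewrite ?expf_neq0 //.
have De : D a * d + a * D d = D n * b + n * D b by rewrite -!(derM dD) e.
apply/eqP; rewrite -subr_eq0; apply/eqP.
transitivity ((D n * b + n * D b - (D a * d + a * D d)) * d * b
  + (a * d - n * b) * (D b * d + D d * b)); first by ring.
by rewrite De e; ring.
Qed.

Lemma frac_der_tofrac a : frac_der a%:F = (D a)%:F.
Proof.
rewrite -[a%:F]divr1 -tofrac1 frac_der_div ?oner_neq0 // (der1 dD).
by rewrite mulr0 mulr1 subr0 expr1n tofrac1 divr1.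
Qed.

Lemma frac_der_derivation : derivation frac_der.
Proof.
split=> f g; rewrite (frac_numden f) (frac_numden g);
 move: (\n_(repr f)) (\d_(repr f)) (denom_ratioP (repr f)) => a b b0;
 move: (\n_(repr g)) (\d_(repr g)) (denom_ratioP (repr g)) => a' b' b0'.
  rewrite addf_div ?tofrac_eq0 // -!tofracM -!tofracD !frac_der_div ?mulf_neq0 //.
  rewrite addf_div ?tofrac_eq0 ?expf_neq0 // -!tofracM -!tofracD.
  apply/frac_eqP; rewrite ?expf_neq0 ?mulf_neq0 ?expf_neq0 //.
  by rewrite (derD dD) !(derM dD); ring.
rewrite mulf_div -!tofracM !frac_der_div ?mulf_neq0 //.
rewrite !mulf_div -!tofracM addf_div ?tofrac_eq0 ?mulf_neq0 ?expf_neq0 //.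
rewrite -!tofracM -!tofracD; apply/frac_eqP; rewrite ?mulf_neq0 ?expf_neq0 ?mulf_neq0 //.
by rewrite !(derM dD); ring.
Qed.
End FracDer.

(** The commutator of two derivations obeys the Leibniz rule; killing numerators and denominators,
    it kills every fraction. *)
Lemma frac_derC (D D' : A -> A) : derivation D -> derivation D' ->
  (forall x, D (D' x) = D' (D x)) ->
  forall f, frac_der D (frac_der D' f) = frac_der D' (frac_der D f).
Proof.
move=> dD dD' C f.
have dF := frac_der_derivation dD; have dF' := frac_der_derivation dD'.
pose K g := frac_der D (frac_der D' g) - frac_der D' (frac_der D g).
have K0 a : K a%:F = 0 by rewrite /K !frac_der_tofrac // C subrr.
have KM g h : K (g * h) = K g * h + g * K h.
  rewrite /K (derM dF' g h) (derM dF g h) (derD dF) (derD dF').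
  rewrite (derM dF (frac_der D' g) h) (derM dF g (frac_der D' h)).
  by rewrite (derM dF' (frac_der D g) h) (derM dF' g (frac_der D h)); ring.
apply/eqP; rewrite -subr_eq0 -[_ - _]/(K f).
have d0 : (\d_(repr f))%:F != 0 by rewrite tofrac_eq0 denom_ratioP.
have e : f * (\d_(repr f))%:F = (\n_(repr f))%:F.
  by rewrite [X in X * _]frac_numden divfK.
have := K0 \n_(repr f); rewrite -e KM K0 mulr0 addr0 => /eqP.
by rewrite mulf_eq0 (negbTE d0) orbF.
Qed.

Section FracMor.
Variable s : {rmorphism A -> A}.
Hypothesis s_inj : injective s.

Definition frac_mor f : {fraction A} :=
  let r := repr f in (s \n_r)%:F / (s \d_r)%:F.

Let s0 b : b != 0 -> s b != 0.
Proof. by rewrite -{2}(rmorph0 s) (inj_eq s_inj). Qed.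

Lemma frac_mor_div (a b : A) : b != 0 ->
  frac_mor (a%:F / b%:F) = (s a)%:F / (s b)%:F.
Proof.
move=> b0; rewrite /frac_mor; set f := a%:F / b%:F.
have := frac_numden f; rewrite {1}/f; have := denom_ratioP (repr f).
move: (\n_(repr f)) (\d_(repr f)) => n d d0 /(frac_eqP _ _ b0 d0) e.
by apply/frac_eqP; rewrite ?s0 // -!rmorphM e.
Qed.

Lemma frac_mor_tofrac a : frac_mor a%:F = (s a)%:F.
Proof.
by rewrite -[a%:F]divr1 -tofrac1 frac_mor_div ?oner_neq0 // rmorph1 tofrac1 divr1.
Qed.

Lemma frac_morD f g : frac_mor (f + g) = frac_mor f + frac_mor g.
Proof.
rewrite (frac_numden f) (frac_numden g).
move: (\n_(repr f)) (\d_(repr f)) (denom_ratioP (repr f)) => a b b0.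
move: (\n_(repr g)) (\d_(repr g)) (denom_ratioP (repr g)) => a' b' b0'.
rewrite addf_div ?tofrac_eq0 // -!tofracM -!tofracD !frac_mor_div ?mulf_neq0 //.
rewrite addf_div ?tofrac_eq0 ?s0 // -!tofracM -!tofracD.
by rewrite rmorphD !rmorphM.
Qed.

Lemma frac_morM f g : frac_mor (f * g) = frac_mor f * frac_mor g.
Proof.
rewrite (frac_numden f) (frac_numden g).
move: (\n_(repr f)) (\d_(repr f)) (denom_ratioP (repr f)) => a b b0.
move: (\n_(repr g)) (\d_(repr g)) (denom_ratioP (repr g)) => a' b' b0'.
rewrite mulf_div -!tofracM !frac_mor_div ?mulf_neq0 //.
by rewrite mulf_div -!tofracM !rmorphM.
Qed.
End FracMor.
End Fractions.

(** * The operators v d/dv and d/dy and the substitution y -> -y *)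

Lemma deriv_derivation (S : comNzRingType) : derivation (@deriv S).
Proof. by split=> p q; rewrite ?derivD ?derivM. Qed.

Lemma map_poly_derivation (S : comNzRingType) (D : S -> S) :
  derivation D -> derivation (map_poly D).
Proof.
move=> dD; have D0 := der0 dD.
split=> p q; apply/polyP => i.
  by rewrite coefD !coef_map_id0 // coefD (derD dD).
rewrite coefD !coefM coef_map_id0 // coefM (der_sum dD) -big_split.
by apply: eq_bigr => j _ /=; rewrite (derM dD) !coef_map_id0.
Qed.

(** This is v d/dv rather than d/dv: it kills the v^0 part, in accordance with a residue taken at
    v^0 y^-1. *)
Definition vdv (p : Rvy) : Rvy := map_poly (fun q => 'X * q^`()) p.

Lemma vdv_coef (p : Rvy) i : (vdv p)`_i = 'X * (p`_i)^`().
Proof. by rewrite coef_map_id0 // deriv0 mulr0. Qed.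

Lemma vdv_derivation : derivation vdv.
Proof.
apply: map_poly_derivation; split=> p q; first by rewrite derivD mulrDr.
by rewrite derivM mulrDr mulrA mulrCA.
Qed.

Lemma vdv_deriv (p : Rvy) : vdv p^`() = (vdv p)^`().
Proof.
by apply/polyP => i; rewrite vdv_coef !coef_deriv vdv_coef derivMn mulrnAr.
Qed.

Definition GL : LK -> LK := frac_der vdv.
Definition subN : {rmorphism Rvy -> Rvy} := comp_poly (- 'X : Rvy).

Lemma ddyE : ddy = frac_der (@deriv _). Proof. by []. Qed.
Lemma negyE : negy = frac_mor subN. Proof. by []. Qed.

Lemma subN_inj : injective subN.
Proof.
apply: (can_inj (g := subN)) => p.
by rewrite /= -comp_polyA linearN /= comp_polyX opprK comp_polyXr.
Qed.

Lemma ddy_derivation : derivation ddy.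
Proof. by rewrite ddyE; apply: frac_der_derivation; exact: deriv_derivation. Qed.
Lemma GL_derivation : derivation GL.
Proof. by apply: frac_der_derivation; exact: vdv_derivation. Qed.
Lemma GL_ddy f : GL (ddy f) = ddy (GL f).
Proof.
rewrite ddyE; apply: frac_derC; first exact: vdv_derivation.
  exact: deriv_derivation.
exact: vdv_deriv.
Qed.

Lemma ddy_tofrac p : ddy (tofrac p) = tofrac p^`().
Proof. by rewrite ddyE frac_der_tofrac //; exact: deriv_derivation. Qed.
Lemma GL_tofrac p : GL (tofrac p) = tofrac (vdv p).
Proof. by rewrite /GL frac_der_tofrac //; exact: vdv_derivation. Qed.
Lemma negy_tofrac p : negy (tofrac p) = tofrac (p \Po - 'X).
Proof. by rewrite negyE frac_mor_tofrac //; exact: subN_inj. Qed.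
Lemma negyD f g : negy (f + g) = negy f + negy g.
Proof. by rewrite negyE frac_morD //; exact: subN_inj. Qed.
Lemma negyM f g : negy (f * g) = negy f * negy g.
Proof. by rewrite negyE frac_morM //; exact: subN_inj. Qed.

Lemma vL_neq0 : vL != 0.
Proof. by rewrite tofrac_eq0 polyC_eq0 polyX_eq0. Qed.
Lemma yL_neq0 : yL != 0.
Proof. by rewrite tofrac_eq0 polyX_eq0. Qed.

Lemma ddy_yL : ddy yL = 1. Proof. by rewrite ddy_tofrac derivX tofrac1. Qed.
Lemma ddy_vL : ddy vL = 0. Proof. by rewrite ddy_tofrac derivC tofrac0. Qed.
Lemma GL_vL : GL vL = vL.
Proof.
rewrite GL_tofrac; congr tofrac; apply/polyP => i.
by rewrite vdv_coef !coefC; case: i => [|i] /=; rewrite ?derivX ?mulr1 // deriv0 mulr0.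
Qed.
Lemma GL_yL : GL yL = 0.
Proof.
rewrite GL_tofrac (_ : vdv _ = 0) ?tofrac0 //; apply/polyP => i.
by rewrite vdv_coef coefX coef0 -polyC_natr derivC mulr0.
Qed.
Lemma negy_yL : negy yL = - yL.
Proof. by rewrite negy_tofrac comp_polyX tofracN. Qed.
Lemma negy_vL : negy vL = vL.
Proof. by rewrite negy_tofrac comp_polyC. Qed.
Lemma negy1 : negy 1 = 1.
Proof. by rewrite -tofrac1 negy_tofrac -polyC1 comp_polyC. Qed.

(** * Laurent polynomials and their residue *)

Definition laur (f : LK) := exists a b p, f * (vL ^+ a * yL ^+ b) = tofrac p.

Lemma laur_tofrac p : laur (tofrac p).
Proof. by exists 0, 0, p; rewrite !expr0 !mulr1. Qed.
Lemma laur0 : laur 0. Proof. by rewrite -tofrac0; exact: laur_tofrac. Qed.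
Lemma laur1 : laur 1. Proof. by rewrite -tofrac1; exact: laur_tofrac. Qed.
Lemma laurD f g : laur f -> laur g -> laur (f + g).
Proof.
move=> [a [b [p ep]]] [a' [b' [p' ep']]].
exists (a + a')%N, (b + b')%N, (p * 'X%:P ^+ a' * 'X ^+ b' + p' * 'X%:P ^+ a * 'X ^+ b).
rewrite tofracD !tofracM -ep -ep' !tofracXn -/vL -/yL !exprD; ring.
Qed.
Lemma laurN f : laur f -> laur (- f).
Proof. by move=> [a [b [p ep]]]; exists a, b, (- p); rewrite tofracN -ep mulNr. Qed.
Lemma laurM f g : laur f -> laur g -> laur (f * g).
Proof.
move=> [a [b [p ep]]] [a' [b' [p' ep']]].
exists (a + a')%N, (b + b')%N, (p * p').
by rewrite tofracM -ep -ep' !exprD; ring.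
Qed.
Lemma laur_vL : laur vL. Proof. exact: laur_tofrac. Qed.
Lemma laur_yL : laur yL. Proof. exact: laur_tofrac. Qed.
Lemma laur_vLV : laur vL^-1.
Proof. by exists 1%N, 0, 1; rewrite expr0 mulr1 expr1 mulVf ?vL_neq0 // tofrac1. Qed.
Lemma laur_yLV : laur yL^-1.
Proof. by exists 0, 1%N, 1; rewrite expr0 mul1r expr1 mulVf ?yL_neq0 // tofrac1. Qed.

(** The clearing monomial of the derivative needs one more power of y, as d/dy deepens a pole at y =
    0 by one. *)
Lemma ddy_mul_mono f a b :
  ddy f * (vL ^+ a * yL ^+ b.+1)
  = ddy (f * (vL ^+ a * yL ^+ b)) * yL - f * (vL ^+ a * yL ^+ b) *+ b.
Proof.
have dd := ddy_derivation.
rewrite !(derM dd) !(derX dd) ddy_vL ddy_yL mulr0 mul0rn mul0r add0r mulr1.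
case: b => [|b]; first by rewrite !mulr0n expr1 expr0; ring.
by rewrite /= -mulrnAr !exprS -[_ *+ b.+1]mulr_natr; ring.
Qed.

Lemma GL_mul_mono f a b :
  GL f * (vL ^+ a * yL ^+ b)
  = GL (f * (vL ^+ a * yL ^+ b)) - f * (vL ^+ a * yL ^+ b) *+ a.
Proof.
have dd := GL_derivation.
rewrite !(derM dd) !(derX dd) GL_vL GL_yL mulr0 mul0rn mulr0 addr0.
case: a => [|a]; first by rewrite !mulr0n expr0; ring.
by rewrite /= !exprS -2![_ *+ a.+1]mulr_natr; ring.
Qed.

Lemma laur_ddy f : laur f -> laur (ddy f).
Proof.
move=> [a [b [p ep]]]; exists a, b.+1, (p^`() * 'X - p *+ b).
by rewrite ddy_mul_mono ep ddy_tofrac tofracB tofracM tofracMn.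
Qed.

Lemma laur_GL f : laur f -> laur (GL f).
Proof.
move=> [a [b [p ep]]]; exists a, b, (vdv p - p *+ a).
by rewrite GL_mul_mono ep GL_tofrac tofracB tofracMn.
Qed.

Lemma laur_negy f : laur f -> laur (negy f).
Proof.
move=> [a [b [p ep]]]; exists a, b, ((p \Po - 'X) * (-1) ^+ b).
have negyX x i : negy (x ^+ i) = negy x ^+ i.
  by elim: i => [|i IH]; rewrite ?expr0 ?negy1 // !exprS negyM IH.
rewrite tofracM -negy_tofrac -ep !negyM !negyX negy_yL negy_vL (exprNn yL) tofracXn tofracN tofrac1.
have e : (-1) ^+ b * (-1) ^+ b = 1 :> LK by rewrite -expr2 sqrr_sign.
by move: ((-1) ^+ b) e => z e; ring: e.
Qed.

(* [x] is the coefficient of [v^0 y^-1] in the Laurent polynomial [f]. *)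
Definition hres (f : LK) (x : rat) :=
  exists a b p, f * (vL ^+ a * yL ^+ b.+1) = tofrac p /\ (p`_b)`_a = x.

(** Lets two Laurent polynomials share a clearing monomial, as additivity of [hres] requires. *)
Lemma hres_raise f a b p c d : f * (vL ^+ a * yL ^+ b.+1) = tofrac p ->
  exists2 q, f * (vL ^+ (a + c) * yL ^+ (b + d).+1) = tofrac q & (q`_(b + d))`_(a + c) = (p`_b)`_a.
Proof.
move=> e; exists (p * 'X%:P ^+ c * 'X ^+ d).
  by rewrite !tofracM !tofracXn -/vL -/yL -e -addSn !exprD; ring.
by rewrite coefMXn ltnNge leq_addl /= addnK -polyC_exp coefMC coefMXn ltnNge leq_addl /= addnK.
Qed.

Lemma hresD f g x x' : hres f x -> hres g x' -> hres (f + g) (x + x').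
Proof.
move=> [a [b [p [ep <-]]]] [a' [b' [p' [ep' <-]]]].
have [q eq <-] := hres_raise a' b' ep; have [q' eq' <-] := hres_raise a b ep'.
exists (a + a')%N, (b + b')%N, (q + q'); split; last first.
  by rewrite !coefD ![(a' + a)%N]addnC ![(b' + b)%N]addnC.
by rewrite tofracD -eq -eq' mulrDl [(a' + a)%N]addnC [(b' + b)%N]addnC.
Qed.

Lemma hresN f x : hres f x -> hres (- f) (- x).
Proof.
move=> [a [b [p [ep <-]]]]; exists a, b, (- p).
by rewrite tofracN -ep mulNr !coefN.
Qed.

Lemma hres0 : hres 0 0.
Proof. by exists 0, 0, 0; rewrite mul0r tofrac0 !coef0. Qed.

Lemma hres_natmul f x n : hres f x -> hres (f *+ n) (x *+ n).
Proof. by move=> h; elim: n => [|n IH]; rewrite ?mulrS ?mulr0n; [exact: hres0|exact: hresD]. Qed.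

Lemma hres_divn f x n : hres (f *+ n.+1) x -> hres f (x / n.+1%:R).
Proof.
move=> [a [b [p [ep <-]]]]; exists a, b, ((n.+1%:R^-1)%:P%:P * p); split.
  rewrite tofracM -ep mulrnAl mulrnAr -mulrnAl -tofracMn -!polyCMn.
  by rewrite -[_^-1 *+ _]mulr_natr mulVf ?pnatr_eq0 // tofrac1 mul1r.
by rewrite !coefCM mulrC.
Qed.

Lemma hres_ddy f : laur f -> hres (ddy f) 0.
Proof.
move=> [a [b [p ep]]]; exists a, b, (p^`() * 'X - p *+ b); split.
  by rewrite ddy_mul_mono ep ddy_tofrac tofracB tofracM tofracMn.
(* The coefficient of y^b in y p' - b p is b p_b - b p_b. *)
rewrite coefB coefMX coefMn; case: b ep => [|b] _ /=; first by rewrite mulr0n subr0 coef0.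
by rewrite coef_deriv subrr coef0.
Qed.

Lemma hres_GL f : laur f -> hres (GL f) 0.
Proof.
move=> [a [b [p ep]]].
have ep' : f * (vL ^+ a * yL ^+ b.+1) = tofrac (p * 'X).
  by rewrite tofracM -ep -/yL exprSr !mulrA.
exists a, b, (vdv (p * 'X) - (p * 'X) *+ a); split.
  by rewrite GL_mul_mono ep' GL_tofrac tofracB tofracMn.
rewrite coefB coefMn vdv_coef coefB coefXM coefMn.
case: a {ep ep'} => [|a] /=; first by rewrite mulr0n subrr.
by rewrite coef_deriv subrr.
Qed.

Lemma hres_yV : hres yL^-1 1.
Proof.
by exists 0, 0, 1; rewrite mul1r expr1 mulVf ?yL_neq0 // tofrac1 coefC /= coefC.
Qed.

(** The weight y v^(1-N) moves the exponents (N - 1, -2) to (0, -1). Its factors v and y enlarge the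
    clearing monomial to v^(a+1) y^(b+2), and v^N goes to the numerator. *)
Lemma hres_lcoef f N x : (0 < N)%N ->
  hres (yL * vL * vL^-1 ^+ N * f) x -> has_lcoef f (N%:Z - 1) (-2) x.
Proof.
move=> N0 [a [b [p [ep <-]]]]; exists a.+1, b.+2, (p * 'X%:P ^+ N); split.
  have e1 : vL^-1 ^+ N * vL ^+ N = 1 by rewrite -exprMn mulVf ?vL_neq0 // expr1n.
  rewrite tofracM -ep tofracXn -/vL (exprS yL b.+1) (exprS vL a).
  by move: (vL^-1 ^+ N) (vL ^+ N) e1 => A B e1; ring: e1.
split; first by lia.
split; first by lia.
rewrite (_ : `|_|%N = b); last by lia.
rewrite (_ : `|_|%N = (a + N)%N); last by lia.
by rewrite -polyC_exp coefMC coefMXn ltnNge leq_addl /= addnK.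
Qed.

(** * Truncated power series *)

(* Power series in the variables [c_k], [k < n], modulo all [c_k ^+ d.+2]: in this
   quotient every series without constant term is nilpotent. *)
Section Exponents.
Variables n d : nat.
(** Exponents range over 0, ..., d + 1, so the exponent 1 of a single variable always fits. *)
Definition expo := {ffun 'I_n -> 'I_d.+2}.
Implicit Types k l m : expo.
Definition ex0 : expo := [ffun => ord0].
Definition exle k m := [forall i, (k i <= m i)%N].
Definition exsub m k : expo := [ffun i => inord (m i - k i)].
Definition exadd m k : expo := [ffun i => inord (m i + k i)].
Definition exdeg m : nat := (\sum_i m i)%N.
Definition exvar (j : 'I_n) : expo := [ffun i => inord (i == j)].

Lemma expoP k m : (forall i, k i = m i :> nat) -> k = m.
Proof. move=> h; apply/ffunP => i; apply: val_inj; exact: h. Qed.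

Lemma exleP k m : reflect (forall i, (k i <= m i)%N) (exle k m).
Proof. exact: forallP. Qed.

Lemma exsubE m k i : exsub m k i = (m i - k i)%N :> nat.
Proof. by rewrite ffunE inordK //; exact: leq_ltn_trans (leq_subr _ _) (ltn_ord _). Qed.

Lemma exvarE j i : exvar j i = (i == j) :> nat.
Proof. by rewrite ffunE inordK //; case: eqP. Qed.

Lemma ex0E i : ex0 i = 0 :> nat. Proof. by rewrite ffunE. Qed.

Lemma exle0 m : exle ex0 m. Proof. by apply/exleP => i; rewrite ex0E. Qed.

Lemma exsub0 m : exsub m ex0 = m.
Proof. by apply: expoP => i; rewrite exsubE ex0E subn0. Qed.

Lemma exle_sub m k : exle (exsub m k) m.
Proof. by apply/exleP => i; rewrite exsubE leq_subr. Qed.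

Lemma exsubK m k : exle k m -> exsub m (exsub m k) = k.
Proof. by move=> /exleP h; apply: expoP => i; rewrite !exsubE subKn. Qed.

Lemma exdeg_sub m k : exle k m -> (exdeg k + exdeg (exsub m k) = exdeg m)%N.
Proof.
move=> /exleP h; rewrite /exdeg -big_split /=.
by apply: eq_bigr => i _; rewrite exsubE subnKC.
Qed.

Lemma exdeg0 : exdeg ex0 = 0%N.
Proof. by rewrite /exdeg big1 // => i _; rewrite ex0E. Qed.

Lemma exdeg_eq0 m : (exdeg m == 0%N) = (m == ex0).
Proof.
apply/eqP/eqP => [|->]; last exact: exdeg0.
move/eqP; rewrite sum_nat_eq0 => /forallP h; apply: expoP => i.
by rewrite ex0E; apply/eqP; have := h i.
Qed.

Lemma exdeg_var j : exdeg (exvar j) = 1%N.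
Proof.
rewrite /exdeg (bigD1 j) //= exvarE eqxx big1 ?addn0 // => i ij.
by rewrite exvarE (negbTE ij).
Qed.

Lemma exdeg_max m : (exdeg m <= n * d.+1)%N.
Proof.
rewrite /exdeg -[X in (_ <= X * _)%N]card_ord -sum_nat_const; apply: leq_sum => i _.
by rewrite -ltnS.
Qed.
End Exponents.

Definition tps (n d : nat) (K : comNzRingType) := {ffun expo n d -> K}.

Section Tps.
Variables (n d : nat) (K : comNzRingType).
Local Notation T := (expo n d).
Local Notation R := (tps n d K).
HB.instance Definition _ := GRing.Zmodule.copy R {ffun T -> K}.

Definition tps_mul (f g : R) : R :=
  [ffun m => \sum_(k | exle k m) f k * g (exsub m k)].
Definition tps_mon (e : T) (x : K) : R := [ffun m => if m == e then x else 0].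

Lemma tps_mulC : commutative tps_mul.
Proof.
move=> f g; apply/ffunP => m; rewrite !ffunE.
rewrite (reindex_onto (exsub m) (exsub m)) /=; last by move=> k; exact: exsubK.
apply: eq_big => [k|k /andP[_ /eqP ->]]; last by rewrite mulrC.
rewrite exle_sub; apply/eqP/idP => [<-|]; [exact: exle_sub|exact: exsubK].
Qed.

(** Both sides are sums over chains k <= p <= m of exponents; the substitution p = k + l cannot
    overflow because p stays below [m]. *)
Lemma tps_mulA : associative tps_mul.
Proof.
move=> f g h; apply/ffunP => m; rewrite !ffunE.
transitivity (\sum_(k | exle k m) \sum_(p | exle p m && exle k p)
   f k * g (exsub p k) * h (exsub m p)).
  apply: eq_bigr => k /exleP km; rewrite ffunE big_distrr /=.
  have addE l : exle l (exsub m k) -> forall i, exadd k l i = (k i + l i)%N :> nat.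
    move=> /exleP hl i; rewrite ffunE inordK // ltnS.
    have := hl i; have := km i; have := ltn_ord (m i); rewrite exsubE.
    move: (nat_of_ord (m i)) (nat_of_ord (k i)) (nat_of_ord (l i)) => a b c; lia.
  rewrite [RHS](reindex_onto (exadd k) (fun p => exsub p k)) /=; last first.
    move=> p /andP[/exleP pm /exleP kp]; apply: expoP => i.
    by rewrite ffunE exsubE subnKC // inordK.
  apply: eq_big => [l|l hl].
    apply/idP/idP => [hl|].
      rewrite -andbA; apply/and3P; split.
      - apply/exleP => i; rewrite addE //; have := (exleP _ _ hl) i.
        have := km i; rewrite exsubE.
        move: (nat_of_ord (m i)) (nat_of_ord (k i)) (nat_of_ord (l i)) => a b c; lia.
      - by apply/exleP => i; rewrite addE // leq_addr.
      - by apply/eqP/expoP => i; rewrite exsubE addE // addKn.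
    move=> /andP[/andP[/exleP h1 /exleP h2] /eqP <-]; apply/exleP => i.
    by rewrite !exsubE leq_sub2r.
  rewrite mulrA; congr (_ * g _ * h _); apply: expoP => i; rewrite !exsubE ?addE //.
    by rewrite addKn.
  by rewrite subnDA.
rewrite (exchange_big_dep (fun p => exle p m)) /=; last by move=> k p _ /andP[].
apply: eq_bigr => p pm; rewrite ffunE big_distrl /=; apply: eq_bigl => k.
rewrite pm andTb andb_idl // => /exleP kp; apply/exleP => i.
exact: leq_trans (kp i) ((exleP _ _ pm) i).
Qed.

Lemma tps_mon_mul e x f m :
  tps_mul (tps_mon e x) f m = if exle e m then x * f (exsub m e) else 0.
Proof.
rewrite ffunE; case: ifP => em.
  rewrite (bigD1 e) //= big1 ?addr0 => [|k /andP[_ ke]]; first by rewrite ffunE eqxx.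
  by rewrite ffunE (negbTE ke) mul0r.
rewrite big1 // => k km; rewrite ffunE; case: eqP => [ke|]; last by rewrite mul0r.
by rewrite ke em in km.
Qed.

Definition tps_one : R := tps_mon (ex0 n d) 1.

Lemma tps_mul1 : left_id tps_one tps_mul.
Proof.
by move=> f; apply/ffunP => m; rewrite tps_mon_mul exle0 exsub0 mul1r.
Qed.

Lemma tps_mulDl : left_distributive tps_mul (@GRing.add R).
Proof.
move=> f g h; apply/ffunP => m; rewrite !ffunE -big_split /=.
by apply: eq_bigr => k _; rewrite ffunE mulrDl.
Qed.

Lemma tps_one_neq0 : tps_one != 0.
Proof.
by apply/eqP => /ffunP/(_ (ex0 n d)) /eqP; rewrite !ffunE eqxx oner_eq0.
Qed.

HB.instance Definition _ := GRing.Zmodule_isComNzRing.Build R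
  tps_mulA tps_mulC tps_mul1 tps_mulDl tps_one_neq0.

Implicit Types f g : R.

Lemma tpsD f g m : (f + g) m = f m + g m. Proof. by rewrite ffunE. Qed.
Lemma tpsN f m : (- f) m = - f m. Proof. by rewrite ffunE. Qed.
Lemma tpsM f g m : (f * g) m = \sum_(k | exle k m) f k * g (exsub m k).
Proof. by rewrite [LHS]ffunE. Qed.
Lemma tps1 m : (1 : R) m = (m == ex0 n d)%:R.
Proof. by rewrite [LHS]ffunE; case: eqP. Qed.
Lemma tps0 m : (0 : R) m = 0. Proof. by rewrite ffunE. Qed.
Lemma tpsMn f m i : (f *+ i) m = f m *+ i.
Proof. by elim: i => [|i IH]; rewrite ?mulr0n ?tps0 // !mulrS tpsD IH. Qed.
Lemma tpsB f g m : (f - g) m = f m - g m. Proof. by rewrite tpsD tpsN. Qed.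
Lemma tps_sum I (r : seq I) (P : pred I) (F : I -> R) m :
  (\sum_(i <- r | P i) F i) m = \sum_(i <- r | P i) F i m.
Proof. exact: (big_morph (fun f : R => f m) (fun f g => tpsD f g m) (tps0 m)). Qed.
Lemma tps_monM e x f m :
  (tps_mon e x * f) m = if exle e m then x * f (exsub m e) else 0.
Proof. exact: tps_mon_mul. Qed.

Definition tpsC (x : K) : R := tps_mon (ex0 n d) x.
Lemma tpsCE x m : tpsC x m = x *+ (m == ex0 n d).
Proof. by rewrite ffunE; case: eqP. Qed.
Lemma tpsCM x f m : (tpsC x * f) m = x * f m.
Proof. by rewrite tps_monM exle0 exsub0. Qed.
Lemma tpsC_mul x y : tpsC x * tpsC y = tpsC (x * y).
Proof. by apply/ffunP => m; rewrite tpsCM !tpsCE mulrnAr. Qed.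
Lemma tpsC1 : tpsC 1 = 1. Proof. by []. Qed.
Lemma tpsCD x y : tpsC (x + y) = tpsC x + tpsC y.
Proof. by apply/ffunP => m; rewrite tpsD !tpsCE mulrnDl. Qed.
Lemma tpsCN x : tpsC (- x) = - tpsC x.
Proof. by apply/ffunP => m; rewrite tpsN !tpsCE mulNrn. Qed.
Lemma tpsCX x i : tpsC x ^+ i = tpsC (x ^+ i).
Proof. by elim: i => [|i IH] //; rewrite !exprS IH tpsC_mul. Qed.
Lemma tpsC_nat i : tpsC i%:R = i%:R.
Proof.
elim: i => [|i IH]; last by rewrite !mulrS tpsCD IH.
by apply/ffunP => m; rewrite tps0 tpsCE mul0rn.
Qed.

Definition cvar (k : nat) : R :=
  if insub k is Some j then tps_mon (exvar d j) 1 else 0.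

(** The c-adic filtration. It is finite, as no exponent has degree above n (d + 1), so convergence
    arguments become equalities. *)
Definition fil (k : nat) f := forall m, (exdeg m < k)%N -> f m = 0.

Lemma filD k f g : fil k f -> fil k g -> fil k (f + g).
Proof. by move=> hf hg m hm; rewrite tpsD hf // hg // addr0. Qed.
Lemma filN k f : fil k f -> fil k (- f).
Proof. by move=> hf m hm; rewrite tpsN hf // oppr0. Qed.
Lemma fil0 k : fil k 0. Proof. by move=> m _; rewrite tps0. Qed.
Lemma filT f : fil 0 f. Proof. by []. Qed.
Lemma filM i j f g : fil i f -> fil j g -> fil (i + j) (f * g).
Proof.
move=> hf hg m hm; rewrite tpsM big1 // => k km.
have := exdeg_sub km; case: (ltnP (exdeg k) i) => hk; first by rewrite hf // mul0r.
by move=> e; rewrite hg ?mulr0 //; lia.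
Qed.
Lemma filMl k f g : fil k g -> fil k (f * g).
Proof. exact: (filM (filT f)). Qed.
Lemma filX i f k : fil i f -> fil (k * i) (f ^+ k).
Proof. by move=> h; elim: k => [|k IH] //; rewrite exprS mulSn; exact: filM. Qed.
Lemma fil_sum k (I : Type) (r : seq I) (P : pred I) (F : I -> R) :
  (forall i, P i -> fil k (F i)) -> fil k (\sum_(i <- r | P i) F i).
Proof. by move=> h; elim/big_rec: _ => [|i x Pi]; [exact: fil0|apply: filD; exact: h]. Qed.
Lemma fil_cvar k : fil 1 (cvar k).
Proof.
move=> m; rewrite ltnS leqn0 exdeg_eq0 => /eqP ->; rewrite /cvar.
case: insubP => [j _ _|_]; last by rewrite tps0.
rewrite ffunE; case: eqP => // /(congr1 (@exdeg n d)).
by rewrite exdeg0 exdeg_var.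
Qed.
Lemma fil_eq0 f : fil (n * d.+1).+1 f -> f = 0.
Proof.
by move=> h; apply/ffunP => m; rewrite tps0 h // ltnS exdeg_max.
Qed.
Lemma fil_nil f : fil 1 f -> f ^+ (n * d.+1).+1 = 0.
Proof. by move=> h; apply: fil_eq0; rewrite -[X in fil X _]muln1; apply: filX. Qed.

Definition tps_map (D : K -> K) f : R := [ffun m => D (f m)].
(** This is the sum of the c_k d/dc_k, that is z d/dz when z rescales all the c_k at once. *)
Definition euler f : R := [ffun m => f m *+ exdeg m].

Lemma tps_mapE D f m : tps_map D f m = D (f m). Proof. by rewrite ffunE. Qed.
Lemma eulerE f m : euler f m = f m *+ exdeg m. Proof. by rewrite ffunE. Qed.

Lemma tps_map_derivation D : derivation D -> derivation (tps_map D).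
Proof.
move=> dD; split=> f g; apply/ffunP => m.
  by rewrite tpsD !tps_mapE tpsD (derD dD).
rewrite tpsD tps_mapE !tpsM (der_sum dD) -big_split; apply: eq_bigr => k _ /=.
by rewrite (derM dD) !tps_mapE.
Qed.

Lemma euler_derivation : derivation euler.
Proof.
split=> f g; apply/ffunP => m; first by rewrite tpsD !eulerE tpsD mulrnDl.
rewrite tpsD eulerE !tpsM -sumrMnl -big_split; apply: eq_bigr => k km /=.
by rewrite !eulerE -(exdeg_sub km) mulrnDr mulrnAl mulrnAr.
Qed.

Lemma euler_map D f : derivation D -> euler (tps_map D f) = tps_map D (euler f).
Proof. by move=> dD; apply/ffunP => m; rewrite !(eulerE, tps_mapE) (der_natmul dD). Qed.

Lemma fil_map D k f : derivation D -> fil k f -> fil k (tps_map D f).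
Proof. by move=> dD h m hm; rewrite tps_mapE h // (der0 dD). Qed.

Lemma tps_map_C D x : derivation D -> tps_map D (tpsC x) = tpsC (D x).
Proof.
by move=> dD; apply/ffunP => m; rewrite tps_mapE !tpsCE (der_natmul dD).
Qed.

Lemma euler_C x : euler (tpsC x) = 0.
Proof.
apply/ffunP => m; rewrite eulerE tpsCE tps0.
by case: eqP => [->|]; rewrite ?exdeg0 ?mulr0n // mul0rn.
Qed.

Lemma tps_map_cvar D k : derivation D -> tps_map D (cvar k) = 0.
Proof.
move=> dD; apply/ffunP => m; rewrite tps_mapE tps0 /cvar.
case: insubP => [j _ _|_]; last by rewrite tps0 (der0 dD).
by rewrite ffunE; case: eqP; rewrite ?(der1 dD) ?(der0 dD).
Qed.

Lemma euler_cvar k : euler (cvar k) = cvar k.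
Proof.
apply/ffunP => m; rewrite eulerE /cvar.
case: insubP => [j _ _|_]; last by rewrite tps0 mul0rn.
by rewrite ffunE; case: eqP => [->|]; rewrite ?exdeg_var ?mulr1n // mul0rn.
Qed.

Lemma tps_map_morM (h : K -> K) : {morph h : x y / x + y} -> {morph h : x y / x * y} ->
  {morph tps_map h : f g / f * g}.
Proof.
move=> hD hM f g; apply/ffunP => m; rewrite tps_mapE !tpsM.
have h0 : h 0 = 0 by apply: (addrI (h 0)); rewrite -hD !addr0.
rewrite (big_morph h hD h0); apply: eq_bigr => k _.
by rewrite hM !tps_mapE.
Qed.

Lemma tps_map_morD (h : K -> K) : {morph h : x y / x + y} ->
  {morph tps_map h : f g / f + g}.
Proof. by move=> hD f g; apply/ffunP => m; rewrite tpsD !tps_mapE tpsD hD. Qed.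
End Tps.

(** * Lagrange inversion *)

Lemma LK_nat_neq0 i : (i.+1%:R : LK) != 0.
Proof.
rewrite -(rmorph_nat (@tofrac Rvy)) tofrac_eq0.
by rewrite -polyC_natr polyC_eq0 -polyC_natr polyC_eq0 pnatr_eq0.
Qed.

Lemma LK_mulrn_inj (x : LK) i j : x *+ i = x *+ j -> i != j -> x = 0.
Proof.
wlog ij : i j / (i <= j)%N.
  move=> h; case: (leqP i j) => [|/ltnW] le e ne; first exact: h le e ne.
  by apply: h le _ _ => //; rewrite eq_sym.
move=> e ne; have : x *+ (j - i) = 0 by rewrite mulrnBr // e subrr.
have -> : (j - i = (j - i).-1.+1)%N by lia.
rewrite -mulr_natr => /eqP; rewrite mulf_eq0 (negbTE (LK_nat_neq0 _)) orbF.
by move/eqP.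
Qed.

Lemma laur_invn i : laur (i.+1%:R^-1).
Proof.
exists 0, 0, ((i.+1%:R^-1)%:P%:P); rewrite !expr0 !mulr1.
apply: (mulfI (LK_nat_neq0 i)); rewrite mulfV ?LK_nat_neq0 //.
have e : (i.+1%:R : Rvy) * (i.+1%:R^-1)%:P%:P = 1.
  by rewrite mulr_natl -!polyCMn -[_^-1 *+ _]mulr_natr mulVf ?pnatr_eq0.
by rewrite -[LHS](tofrac1 Rvy) -e tofracM rmorph_nat.
Qed.

Section Laurent.
Variables (n d : nat) (K : comNzRingType) (lau : K -> Prop).
Hypotheses (lau0 : lau 0) (lau1 : lau 1) (lauN : forall x, lau x -> lau (- x))
  (lauD : forall x y, lau x -> lau y -> lau (x + y))
  (lauM : forall x y, lau x -> lau y -> lau (x * y)).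
Local Notation R := (tps n d K).
Definition laurs (f : R) := forall m, lau (f m).

Lemma laursD f g : laurs f -> laurs g -> laurs (f + g).
Proof. by move=> hf hg m; rewrite tpsD; apply: lauD. Qed.
Lemma laursN f : laurs f -> laurs (- f).
Proof. by move=> hf m; rewrite tpsN; apply: lauN. Qed.
Lemma laursM f g : laurs f -> laurs g -> laurs (f * g).
Proof.
move=> hf hg m; rewrite tpsM; elim/big_rec: _ => [|k x _ hx] //.
by apply: lauD hx; apply: lauM.
Qed.
Lemma laursC x : lau x -> laurs (tpsC n d x).
Proof. by move=> hx m; rewrite tpsCE; case: eqP => _; rewrite ?mulr0n ?mulr1n. Qed.
Lemma laurs1 : laurs 1. Proof. by exact: laursC. Qed.
Lemma laurs_cvar k : laurs (cvar n d K k).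
Proof.
move=> m; rewrite /cvar; case: insubP => [j _ _|_]; last by rewrite tps0.
by rewrite ffunE; case: eqP.
Qed.
Lemma laurs_map (D : K -> K) f :
  (forall x, lau x -> lau (D x)) -> laurs f -> laurs (tps_map D f).
Proof. by move=> hD h m; rewrite tps_mapE; apply: hD. Qed.
Lemma laurs_euler f : laurs f -> laurs (euler f).
Proof.
move=> h m; rewrite eulerE; elim: (exdeg m) => [|i IH] //.
by rewrite mulrS; apply: lauD.
Qed.
Lemma laurs_sum (I : Type) (r : seq I) (P : pred I) (F : I -> R) :
  (forall i, laurs (F i)) -> laurs (\sum_(i <- r | P i) F i).
Proof.
by move=> h; elim/big_rec: _ => [m|i x _ hx]; [rewrite tps0|exact: laursD].
Qed.
Lemma laursX f i : laurs f -> laurs (f ^+ i).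
Proof. by move=> h; elim: i => [|i IH]; [exact: laurs1|rewrite exprS; exact: laursM]. Qed.
End Laurent.

Section Lagrange.
Variables (n d : nat) (K : comNzRingType) (D : K -> K) (lau : K -> Prop).
Variables (yK yiK vK viK hK : K).
Hypotheses (dD : derivation D) (yyiK : yK * yiK = 1) (hK2 : hK * 2%:R = 1).
Hypotheses (D_y : D yK = 1) (D_v : D vK = 0) (D_vi : D viK = 0) (D_h : D hK = 0).
Hypothesis mulrn_inj : forall (x : K) i j, x *+ i = x *+ j -> i != j -> x = 0.
Hypotheses (lau0 : lau 0) (lau1 : lau 1) (lauN : forall x, lau x -> lau (- x))
  (lauD : forall x y, lau x -> lau y -> lau (x + y))
  (lauM : forall x y, lau x -> lau y -> lau (x * y)).
Hypotheses (lau_y : lau yK) (lau_yi : lau yiK) (lau_v : lau vK) (lau_vi : lau viK)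
  (lau_h : lau hK).
Local Notation R := (tps n d K).
Local Notation C := (@tpsC n d K).
Local Notation c := (cvar n d K).
Local Notation laurs := (@laurs n d K lau).
Let lD := laursD (n := n) (d := d) lauD.
Let lN := laursN (n := n) (d := d) lauN.
Let lM := laursM (n := n) (d := d) lau0 lauD lauM.
Let lC := laursC (n := n) (d := d) lau0.
Let lX := laursX (n := n) (d := d) lau0 lau1 lauD lauM.

Let y : R := C yK.
Let yi : R := C yiK.
Let v : R := C vK.
Let vi : R := C viK.
Let h2 : R := C hK.

Definition Afun (x : R) : R := \sum_(k < n) c k * (v ^+ k * vi * (1 + x) ^+ (2 * k)).
Definition ths (f : R) : R := yi * tps_map D f.

Lemma tpsC_inv : y * yi = 1. Proof. by rewrite /y /yi tpsC_mul yyiK. Qed.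
Lemma tpsC_half : h2 * 2%:R = 1.
Proof. by rewrite /h2 -tpsC_nat tpsC_mul hK2. Qed.

Lemma two_inj (f g : R) : 2%:R * f = 2%:R * g -> f = g.
Proof. by move/(congr1 ( *%R h2)); rewrite !mulrA tpsC_half !mul1r. Qed.

Lemma fil_Afun x : fil 1 (Afun x).
Proof. by apply: fil_sum => k _; rewrite mulrC; apply: filMl; exact: fil_cvar. Qed.

Lemma fil_AfunB x x' j : fil j (x - x') -> fil j.+1 (Afun x - Afun x').
Proof.
move=> h; rewrite /Afun -sumrB; apply: fil_sum => k _.
rewrite -mulrBr -mulrBr subrXX -add1n; apply: filM; first exact: fil_cvar.
apply: filMl; rewrite mulrC; apply: filMl.
by rewrite (_ : _ - _ = x - x') //; ring.
Qed.

Lemma laurs_Afun x : laurs x -> laurs (Afun x).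
Proof.
move=> hx; apply: laurs_sum => // k; apply: lM; first exact: laurs_cvar.
apply: lM; first by apply: lM; [apply: lX|]; apply: lC.
by apply: lX; apply: lD hx; exact: laurs1.
Qed.

(** Y = y + u solves Y^2 = y^2 + 2 A(Y) exactly when [u] is a fixed point of [phi]. *)
Let phi (u : R) : R := yi * (Afun (y + u) - h2 * u ^+ 2).

(** A contraction: [Afun] gains one order from its factor [c k], and the quadratic term gains one
    from u + u'. *)
Lemma fil_phiB u u' i : fil 1 u -> fil 1 u' -> fil i (u - u') ->
  fil i.+1 (phi u - phi u').
Proof.
move=> fu fu' h; rewrite /phi -mulrBr; apply: filMl.
have -> : Afun (y + u) - h2 * u ^+ 2 - (Afun (y + u') - h2 * u' ^+ 2)
  = (Afun (y + u) - Afun (y + u')) - h2 * ((u + u') * (u - u')).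
  by move: (Afun _) (Afun _) (h2) => a a' h'; ring.
apply: filD; first by apply: fil_AfunB; rewrite opprD addrACA subrr add0r.
by apply: filN; apply: filMl; rewrite -[i.+1]add1n; apply: filM h; apply: filD.
Qed.

Lemma Afun_solution :
  exists Y : R, [/\ fil 1 (Y - y), Y ^+ 2 = y ^+ 2 + 2%:R * Afun Y & laurs Y].
Proof.
pose u i := iter i phi 0.
have fu i : fil 1 (u i).
  elim: i => [|i IH]; first exact: fil0.
  apply: filMl; apply: filD; first exact: fil_Afun.
  by apply: filN; apply: filMl; rewrite exprS; apply: filMl; rewrite expr1.
have lu i : laurs (u i).
  elim: i => [m|i IH]; first by rewrite tps0.
  apply: lM; first exact: lC.
  apply: lD; first by apply: laurs_Afun; apply: lD IH; exact: lC.
  by apply: lN; apply: lM; [exact: lC|exact: lX].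
have contr i : fil i.+1 (u i.+1 - u i).
  elim: i => [|i IH]; first by rewrite subr0.
  exact: (fil_phiB (fu i.+1) (fu i) IH).
(* After n (d + 1) iterations the next difference has order above the top degree. *)
pose z := u (n * d.+1)%N; have fix_z : phi z = z.
  by apply/eqP; rewrite -subr_eq0; apply/eqP/fil_eq0; exact: contr.
have fz : fil 1 z by exact: fu.
have lz : laurs z by exact: lu.
clearbody z; exists (y + z); split.
- by rewrite addrAC subrr add0r.
- have e : Afun (y + z) = y * z + h2 * z ^+ 2.
    by rewrite -[X in y * X]fix_z /phi mulrA tpsC_inv mul1r subrK.
  rewrite e mulrDr [in RHS](mulrA 2%:R h2) [2%:R * h2]mulrC tpsC_half.
  by move: (y) => y'; ring.
- by apply: lD lz; exact: lC.
Qed.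

Let dd := tps_map_derivation n d dD.
Let dE := euler_derivation n d K.

Lemma ths_derivation : derivation ths.
Proof.
by split=> f g; rewrite /ths ?(derD dd) ?(derM dd); ring.
Qed.
Let dth := ths_derivation.

Lemma euler_ths f : euler (ths f) = ths (euler f).
Proof.
rewrite /ths (derM dE) (euler_map _ dD) /yi euler_C mul0r add0r //.
Qed.

Lemma fil_ths k f : fil k f -> fil k (ths f).
Proof. by move=> h; apply: filMl; apply: fil_map h; exact: dD. Qed.

Lemma ths_y : ths y = yi.
Proof. by rewrite /ths /y (tps_map_C _ _ _ dD) D_y mulr1. Qed.

Lemma ths_const x : D x = 0 -> ths (C x) = 0.
Proof.
move=> h; rewrite /ths (tps_map_C _ _ _ dD) h.
by apply/ffunP => m; rewrite mulrC tpsCM mul0r tps0.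
Qed.

Definition Ader x : R := \sum_(k < n) c k * (v ^+ k * vi * ((1 + x) ^+ (2 * k).-1 *+ (2 * k))).

Lemma ths_Afun x : ths (Afun x) = Ader x * ths x.
Proof.
rewrite /Afun (der_sum dth) big_distrl; apply: eq_bigr => k _ /=.
rewrite (derM dth) [ths (c k)](_ : _ = 0) ?mul0r ?add0r; last first.
  by rewrite /ths (tps_map_cvar _ _ _ dD) mulr0.
rewrite -[RHS]mulrA; congr (_ * _); rewrite (derM dth) (derM dth (v ^+ k)) (derX dth v).
rewrite [ths v](ths_const D_v) [ths vi](ths_const D_vi) mulr0 mul0rn mul0r mulr0 addr0 mul0r add0r.
rewrite (derX dth) (derD dth) (der1 dth) add0r -!mulrA; congr (_ * (_ * _)).
by rewrite mulrnAl.
Qed.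

Lemma euler_Afun x : euler (Afun x) = Afun x + Ader x * euler x.
Proof.
rewrite /Afun (der_sum dE) /Ader big_distrl -big_split; apply: eq_bigr => k _ /=.
rewrite (derM dE) euler_cvar; congr (_ + _).
rewrite -[RHS]mulrA; congr (_ * _); rewrite (derM dE) (derM dE (v ^+ k)) (derX dE v).
rewrite /v /vi !euler_C mulr0 mul0rn mul0r mulr0 addr0 mul0r add0r.
rewrite (derX dE) (derD dE) (der1 dE) add0r -!mulrA; congr (_ * (_ * _)).
by rewrite mulrnAl.
Qed.

Lemma fil_mulB k (a a' b b' : R) :
  fil k ((a - a') * b) -> fil k (a' * (b - b')) -> fil k (a * b - a' * b').
Proof.
move=> h h'; have -> : a * b - a' * b' = (a - a') * b + a' * (b - b') by ring.
exact: filD.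
Qed.

Section Solution.
Variable Y : R.
Hypothesis Yy : fil 1 (Y - y).
Hypothesis YE : Y ^+ 2 = y ^+ 2 + 2%:R * Afun Y.
Let B := Afun Y.
Let A0 := Afun y.
Let F := Y + h2 * Y ^+ 2.

Let thY : (Y - Ader Y) * ths Y = 1.
Proof.
have := congr1 ths YE; rewrite (derD dth) !(derX dth) (derM dth 2%:R) (der_nat dth) mul0r add0r.
rewrite ths_y ths_Afun /= !expr1 tpsC_inv => e; apply: two_inj.
transitivity ((Y * ths Y) *+ 2 - 2%:R * (Ader Y * ths Y)); first by ring.
by rewrite e; ring.
Qed.

(** Applying [ths] and [euler] to the equation of [Y] gives the same factor Y - A'(Y), against 1 and
    [B] respectively. This is the transport equation on which Lagrange inversion rests. *)
Let EY : euler Y = B * ths Y.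
Proof.
have e1 : (Y - Ader Y) * euler Y = B.
  have := congr1 (@euler n d K) YE.
  rewrite (derD dE) !(derX dE) (derM dE 2%:R) (der_nat dE) mul0r add0r euler_Afun.
  rewrite /y euler_C mulr0 mul0rn add0r /= expr1 => e; apply: two_inj.
  transitivity ((Y * euler Y) *+ 2 - 2%:R * (Ader Y * euler Y)); first by ring.
  by rewrite e -/B; ring.
rewrite -[LHS]mulr1 -thY -e1; ring.
Qed.

Let thh2 : ths h2 = 0.
Proof.
exact: ths_const.
Qed.

Let thF : ths F = (1 + Y) * ths Y.
Proof.
rewrite /F (derD dth) (derM dth) thh2 (derX dth) mul0r add0r /= expr1.
transitivity (ths Y + (h2 * 2%:R) * (Y * ths Y)); first by ring.
by rewrite tpsC_half; ring.
Qed.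

Let EF : euler F = B * ths F.
Proof.
rewrite thF /F (derD dE) (derM dE) (derX dE) /h2 euler_C -/h2 mul0r add0r /= expr1 EY.
transitivity (B * ths Y + (h2 * 2%:R) * (Y * (B * ths Y))); first by ring.
by rewrite tpsC_half; ring.
Qed.

Let EB : euler B = B + B * ths B.
Proof. by rewrite euler_Afun EY ths_Afun -/B; ring. Qed.

Let W r := iter r ths (B ^+ r.+1 * ths F).

Lemma euler_iter r f : euler (iter r ths f) = iter r ths (euler f).
Proof. by elim: r => //= r IH; rewrite euler_ths IH. Qed.

Lemma iter_ths_linear r : {morph iter r ths : f g / f + g} /\
  (forall f k, iter r ths (f *+ k) = iter r ths f *+ k).
Proof.
elim: r => [|r [IH1 IH2]] //; split=> [f g|f k] /=.
  by rewrite IH1 (derD dth).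
by rewrite IH2 (der_natmul dth).
Qed.

Let EW r : euler (W r) = W r *+ r.+1 + W r.+1.
Proof.
rewrite /W euler_iter [in RHS]iterSr -(iter_ths_linear r).2 -(iter_ths_linear r).1.
congr (iter r ths _).
rewrite (derM dE) (derX dE) euler_ths EF EB (derM dth B) (derM dth (B ^+ r.+2)) (derX dth).
by rewrite /= !exprS; ring.
Qed.

(** By [EW], [W r] is E (E - 1) ... (E - r) F with E = [euler], and E acts on each coefficient by
    its degree. *)
Let W_coef r m : W r m = F m *+ (exdeg m ^_ r.+1).
Proof.
elim: r => [|r IH]; first by rewrite ffactn1 /W /= expr1 -EF eulerE.
have -> : W r.+1 = euler (W r) - W r *+ r.+1 by rewrite EW addrAC subrr add0r.
rewrite tpsB tpsMn eulerE IH [in RHS]ffactnSr.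
case: (leqP r.+1 (exdeg m)) => h; last by rewrite ffact_small ?mul0n ?mulr0n ?mul0rn ?subr0.
by rewrite -!mulrnA -mulrnBr ?leq_mul2l ?h ?orbT // -mulnBr.
Qed.

(** In the lowest degree r + 1, [Y] may be replaced by [y]; the factor 1 + 1/y is the value of
    [ths F] there. *)
Let fil_WB r : fil r.+2 (B ^+ r.+1 * ths F - A0 ^+ r.+1 * (1 + yi)).
Proof.
have thH : 1 + yi = ths (y + h2 * y ^+ 2).
  rewrite (derD dth) (derM dth) thh2 (derX dth) mul0r add0r ths_y /= expr1.
  by rewrite tpsC_inv -mulr_natr mul1r tpsC_half addrC.
have hB : fil 2 (B - A0) by apply: fil_AfunB.
have hX k : fil k.+1 (B ^+ k - A0 ^+ k).
  elim: k => [|k IH]; first by rewrite subrr; exact: fil0.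
  rewrite 2!exprS; apply: fil_mulB.
    rewrite -[k.+2]add2n; apply: filM => //; rewrite -[X in fil X _]muln1.
    by apply: filX; exact: fil_Afun.
  by rewrite -[k.+2]add1n; apply: filM IH; exact: fil_Afun.
apply: fil_mulB; first by rewrite mulrC; apply: filMl; exact: hX.
rewrite -[r.+2]addn1; apply: filM.
  by rewrite -[X in fil X _]muln1; apply: filX; exact: fil_Afun.
rewrite thH -(derB dth); apply: fil_ths.
rewrite /F (_ : _ - _ = (1 + h2 * (Y + y)) * (Y - y)); last by ring.
exact: filMl.
Qed.

(* Lagrange inversion: with [z] marking degree, [dF/dz = A(S) dF/ds] gives by induction
   [d^r F/dz^r = (d/ds)^(r-1) (A(S)^r dF/ds)], to be evaluated at [z = 0]. *)
Lemma lagrange_inversion m r : exdeg m = r.+1 ->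
  (Y + h2 * Y ^+ 2) m *+ (r.+1)`! = iter r ths (A0 ^+ r.+1 * (1 + yi)) m.
Proof.
move=> mr; have -> : iter r ths (A0 ^+ r.+1 * (1 + yi)) m = W r m.
  apply/eqP; rewrite eq_sym -subr_eq0 -tpsB; apply/eqP.
  have -> : W r - iter r ths (A0 ^+ r.+1 * (1 + yi))
     = iter r ths (B ^+ r.+1 * ths F - A0 ^+ r.+1 * (1 + yi)).
    rewrite (iter_ths_linear r).1; congr (_ + _).
    by elim: (r in iter r) => //= k IH; rewrite -(derN dth) IH.
  suff h : fil r.+2 (iter r ths (B ^+ r.+1 * ths F - A0 ^+ r.+1 * (1 + yi))).
    by rewrite h // mr.
  by elim: (r in iter r) => [|k IH]; [exact: fil_WB|exact: fil_ths].
by rewrite W_coef mr ffactnn.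
Qed.
End Solution.

(** A(y)^r is an eigenvector of [euler] with eigenvalue r, and distinct integers are separated by
    [mulrn_inj]. *)
Lemma A0_homog r m : exdeg m != r -> (Afun y ^+ r) m = 0.
Proof.
move=> h; apply: (mulrn_inj _ h); rewrite -eulerE -tpsMn.
rewrite (derX dE) euler_Afun /y euler_C mulr0 addr0 -/y.
by case: r {h} => [|r]; rewrite ?mulr0n //= -exprSr.
Qed.
End Lagrange.

(** * Series as functions of sorted lists *)

Section Monomials.
Variables n d : nat.
Local Notation T := (expo n d).
Implicit Types k m : T.

Definition expo_seq m : seq nat :=
  sort leq (flatten [seq nseq (m i) (val i) | i <- enum 'I_n]).
Definition seq_expo (mu : seq nat) : T := [ffun i => inord (count_mem (val i) mu)].

Lemma sorted_expo_seq m : sorted leq (expo_seq m).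
Proof. exact/sort_sorted/leq_total. Qed.

Lemma count_expo_seq m a : count a (expo_seq m) = (\sum_i a (val i) * m i)%N.
Proof.
rewrite /expo_seq (permP (permEl (perm_sort _ _))) count_flatten -map_comp sumnE big_map.
by rewrite big_enum; apply: eq_bigr => i _ /=; rewrite count_nseq.
Qed.

Lemma count_mem_expo_seq m (i : 'I_n) : count_mem (val i) (expo_seq m) = m i.
Proof.
rewrite count_expo_seq (bigD1 i) //= eqxx mul1n big1 ?addn0 // => j ji.
by rewrite (inj_eq val_inj) (negbTE ji).
Qed.

Lemma count_mem_expo_seq_ge m a : (n <= a)%N -> count_mem a (expo_seq m) = 0%N.
Proof.
move=> h; rewrite count_expo_seq big1 // => j _ /=; case: eqP => // e.
by have := ltn_ord j; rewrite e ltnNge h.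
Qed.

Lemma size_expo_seq m : size (expo_seq m) = exdeg m.
Proof.
by rewrite -count_predT count_expo_seq; apply: eq_bigr => i _; rewrite /= mul1n.
Qed.

Lemma expo_seq_unique m s : sorted leq s -> (forall i : 'I_n, count_mem (val i) s = m i) ->
  (forall a, (n <= a)%N -> count_mem a s = 0%N) -> s = expo_seq m.
Proof.
move=> ss h1 h2; apply: (sorted_eq leq_trans anti_leq) => //; first exact: sorted_expo_seq.
apply/allP => a _ /=; apply/eqP; case: (ltnP a n) => an.
  by rewrite -[a]/(val (Ordinal an)) h1 count_mem_expo_seq.
by rewrite h2 // count_mem_expo_seq_ge.
Qed.

Lemma expo_seq_inj : injective expo_seq.
Proof. by move=> k m e; apply: expoP => i; rewrite -!count_mem_expo_seq e. Qed.

Lemma count_submon m k a : exle k m -> (count_mem a (expo_seq k) <= count_mem a (expo_seq m))%N.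
Proof.
move=> /exleP h; case: (ltnP a n) => an; last by rewrite !count_mem_expo_seq_ge.
by rewrite -[a]/(val (Ordinal an)) !count_mem_expo_seq.
Qed.

Lemma mem_bitseqs (b : bitseq) : b \in bitseqs (size b).
Proof.
elim: b => //= x b IH; rewrite !mem_cat.
by case: x; rewrite (map_f (cons _) IH) ?orbT.
Qed.

Lemma mem_submons al mu : (al \in submons mu) = subseq al mu.
Proof.
rewrite mem_undup; apply/mapP/subseqP => [[b _ ->]|[b sb ->]].
  by apply/subseqP; exact: mask_subseq.
by exists b => //; rewrite -sb mem_bitseqs.
Qed.

Lemma expo_seq_subseq k m : subseq (expo_seq k) (expo_seq m) = exle k m.
Proof.
apply/idP/exleP => [h i|h].
  by rewrite -!count_mem_expo_seq; exact: leq_count_subseq.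
have /count_subseqP [s sm ks] : forall a, (count_mem a (expo_seq k) <= count_mem a (expo_seq m))%N.
  by move=> a; apply: count_submon; apply/exleP.
suff -> : expo_seq k = s by [].
apply: (sorted_eq leq_trans anti_leq) => //; first exact: sorted_expo_seq.
exact: subseq_sorted leq_trans _ _ sm (sorted_expo_seq m).
Qed.

Lemma subseq_expo_seq s m : subseq s (expo_seq m) -> exists k, s = expo_seq k.
Proof.
move=> h; exists (seq_expo s); apply: expo_seq_unique.
- exact: subseq_sorted leq_trans _ _ h (sorted_expo_seq m).
- move=> i; rewrite ffunE inordK //.
  by apply: leq_ltn_trans (leq_count_subseq _ h) _; rewrite count_mem_expo_seq.
- move=> a an; apply/eqP; rewrite -leqn0 -(@count_mem_expo_seq_ge m a an).
  exact: leq_count_subseq.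
Qed.

(** Sublists of a sorted list, taken without repetition, are exactly the divisors of the monomial;
    hence [smul] is the product of power series. *)
Lemma perm_submons m :
  perm_eq (submons (expo_seq m)) [seq expo_seq k | k <- enum [pred k : T | exle k m]].
Proof.
apply: uniq_perm; [exact: undup_uniq|by rewrite map_inj_uniq ?enum_uniq //; exact: expo_seq_inj|].
move=> s; rewrite mem_submons; apply/idP/mapP => [h|[k]].
  by have [k e] := subseq_expo_seq h; exists k => //; rewrite mem_enum inE -expo_seq_subseq -e.
by rewrite mem_enum inE -expo_seq_subseq => h ->.
Qed.

Lemma count_mdiff mu al a : count_mem a (mdiff mu al) = (count_mem a mu - count_mem a al)%N.
Proof.
elim: al => [|x al IH] /=; first by rewrite subn0.
by rewrite count_mem_rem IH addnC subnDA.
Qed.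

Lemma mdiff_subseq mu al : subseq (mdiff mu al) mu.
Proof.
elim: al => [|x al IH] /=; first exact: subseq_refl.
exact: subseq_trans (rem_subseq _ _) IH.
Qed.

Lemma mdiff_expo_seq m k : exle k m -> mdiff (expo_seq m) (expo_seq k) = expo_seq (exsub m k).
Proof.
move=> km; apply: expo_seq_unique.
- exact: subseq_sorted leq_trans _ _ (mdiff_subseq _ _) (sorted_expo_seq m).
- by move=> i; rewrite count_mdiff !count_mem_expo_seq exsubE.
- by move=> a an; rewrite count_mdiff !count_mem_expo_seq_ge.
Qed.

Lemma expo_seq_eq0 m : (expo_seq m == [::]) = (m == ex0 n d).
Proof. by rewrite -size_eq0 size_expo_seq exdeg_eq0. Qed.

Lemma seq_expoK mu : sorted leq mu -> (forall a, a \in mu -> (a < n)%N) ->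
  (size mu <= d.+1)%N -> expo_seq (seq_expo mu) = mu.
Proof.
move=> h1 h2 h3; symmetry; apply: expo_seq_unique => //.
  by move=> i; rewrite ffunE inordK // ltnS (leq_trans (count_size _ _)).
move=> a an; apply/count_memPn; apply/negP => /h2; rewrite ltnNge an //.
Qed.

Lemma expo_seq_single m a : (expo_seq m == [:: a]) = (m == seq_expo [:: a]) && (a < n)%N.
Proof.
case: (ltnP a n) => an; last first.
  rewrite andbF; apply/eqP => e; have := @count_mem_expo_seq_ge m a an.
  by rewrite e /= eqxx.
rewrite andbT -(inj_eq expo_seq_inj) seq_expoK // => b; by rewrite inE => /eqP ->.
Qed.
End Monomials.

Section Translation.
Variables n d : nat.
Local Notation R := (tps n d LK).

Definition tps_of (f : ser) : R := [ffun m => f (expo_seq m)].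

Lemma tps_ofE f m : tps_of f m = f (expo_seq m). Proof. by rewrite ffunE. Qed.

Lemma tps_of_mul f g : tps_of (smul f g) = tps_of f * tps_of g.
Proof.
apply/ffunP => m; rewrite tpsM tps_ofE /smul (perm_big _ (perm_submons m)) big_map.
rewrite big_enum; apply: eq_bigr => k km.
by rewrite !tps_ofE mdiff_expo_seq.
Qed.

Lemma tps_of_one : tps_of sone = 1.
Proof. by apply/ffunP => m; rewrite tps_ofE tps1 /sone expo_seq_eq0. Qed.

Lemma tps_of_pow f r : tps_of (spow f r) = tps_of f ^+ r.
Proof.
elim: r => [|r IH]; first exact: tps_of_one.
by rewrite exprS -IH -tps_of_mul.
Qed.

Lemma tps_of_A : tps_of Aser = Afun vL vL^-1 (tpsC n d yL).
Proof.
apply/ffunP => m; rewrite tps_ofE /Afun tps_sum.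
have E (k : 'I_n) : (cvar n d LK k * (tpsC n d vL ^+ k * tpsC n d vL^-1
      * (1 + tpsC n d yL) ^+ (2 * k))) m
    = if m == exvar d k then vL ^+ k / vL * (1 + yL) ^+ (2 * k) else 0.
  rewrite -tpsC1 -tpsCD !tpsCX !tpsC_mul /cvar valK.
  rewrite tps_monM mul1r tpsCE; have [->|ne] := eqVneq m (exvar d k).
    case: ifP => [_|/exleP []//].
    by rewrite (_ : exsub _ _ = ex0 n d) ?eqxx //; apply: expoP => i; rewrite exsubE ex0E subnn.
  case: ifP => // /exleP le; case: eqP => // e; case/eqP: ne; apply: expoP => i.
  by apply/eqP; rewrite eqn_leq le andbT -subn_eq0 -exsubE e ex0E.
transitivity (\sum_(k < n) if m == exvar d k then vL ^+ k / vL * (1 + yL) ^+ (2 * k) else 0);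
  last by apply: eq_bigr => k _; rewrite E.
have size1 (k : 'I_n) : m = exvar d k -> size (expo_seq m) = 1%N.
  by move=> ->; rewrite size_expo_seq exdeg_var.
case e: (expo_seq m) => [|a [|b s]] /=.
- by rewrite big1 // => k _; case: eqP => // /size1; rewrite e.
- have : expo_seq m == [:: a] by rewrite e.
  rewrite expo_seq_single => /andP[/eqP -> an].
  have -> : seq_expo n d [:: a] = exvar d (Ordinal an).
    by apply: expoP => i; rewrite !ffunE /= addn0 eq_sym.
  rewrite (bigD1 (Ordinal an)) //= eqxx big1 ?addr0 // => k ka.
  case: eqP => // /ffunP/(_ k)/(congr1 (@nat_of_ord _)).
  by rewrite !exvarE eqxx (negbTE ka).
by rewrite big1 // => k _; case: eqP => // /size1; rewrite e.
Qed.
End Translation.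

(** * The coefficient of the power of the odd part *)

Lemma ddy_vLV : ddy vL^-1 = 0.
Proof.
by rewrite (der_inv ddy_derivation (mulfV vL_neq0)) ddy_vL mulr0 oppr0.
Qed.

Lemma ddy_half : ddy 2%:R^-1 = 0.
Proof.
by rewrite (der_inv ddy_derivation (mulfV (LK_nat_neq0 1))) (der_nat ddy_derivation) mulr0 oppr0.
Qed.

Lemma negyV x : x != 0 -> negy x = x -> negy x^-1 = x^-1.
Proof.
move=> x0 e; apply: (mulfI x0); rewrite mulfV // -[X in X * _]e -negyM mulfV //.
exact: negy1.
Qed.

Lemma negy_half : negy 2%:R^-1 = 2%:R^-1.
Proof.
apply: negyV; first exact: LK_nat_neq0.
by rewrite (mulrSr 1 1) negyD negy1.
Qed.

Lemma half2 : (2%:R^-1 : LK) * 2%:R = 1.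
Proof. by rewrite mulVf ?LK_nat_neq0. Qed.

Section Series.
Variables n d : nat.
Local Notation R := (tps n d LK).
Local Notation C := (@tpsC n d LK).
Local Notation A := (@Afun n d LK vL vL^-1).

Lemma iter_thsE r (f : R) m : iter r (ths ddy yL^-1) f m = iter r theta (f m).
Proof. by elim: r => //= r IH; rewrite /ths tpsCM tps_mapE IH. Qed.

Lemma theta0 : theta 0 = 0.
Proof. by rewrite /theta (der0 ddy_derivation) mulr0. Qed.

(** T = y + F(Y) - F(y) for F(y) = y + y^2/2; the subtracted term only corrects the coefficient of
    degree 0, where Lagrange's formula says nothing. *)
Lemma tps_of_T (Y : R) : fil 1 (Y - C yL) ->
  Y ^+ 2 = C yL ^+ 2 + 2%:R * A Y ->
  tps_of n d Tser = Y + C 2%:R^-1 * Y ^+ 2 - C 2%:R^-1 * C yL ^+ 2.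
Proof.
move=> Yy YE; apply/ffunP => m.
rewrite tps_ofE tpsB [in RHS]tpsCX tpsC_mul tpsCE /Tser /sadd /psum1 size_expo_seq expo_seq_eq0.
have [->|m0] := eqVneq m (ex0 n d).
  rewrite exdeg0 big_geq // addr0 mul1r mulr1n tpsD tpsCM.
  have Y0 : Y (ex0 n d) = yL.
    have := Yy (ex0 n d); rewrite exdeg0 tpsB tpsCE eqxx mulr1n => /(_ isT) /eqP.
    by rewrite subr_eq0 => /eqP.
  have -> : (Y ^+ 2) (ex0 n d) = yL ^+ 2.
    have : fil 1 (Y ^+ 2 - C yL ^+ 2) by rewrite subr_sqr mulrC; exact: filMl.
    move/(_ (ex0 n d)); rewrite exdeg0 tpsB tpsCX tpsCE eqxx mulr1n => /(_ isT) /eqP.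
    by rewrite subr_eq0 => /eqP.
  by rewrite Y0 addrK.
rewrite mul0r add0r mulr0n subr0.
case e: (exdeg m) => [|r]; first by move/eqP: e; rewrite exdeg_eq0 (negbTE m0).
have S0 j : spow Aser j (expo_seq m) = (A (C yL) ^+ j) m.
  by rewrite -tps_ofE tps_of_pow tps_of_A.
(* By homogeneity of A(y)^r only the summand whose index equals the degree of the monomial
   survives. *)
rewrite big_nat_recr // -[RHS]add0r; congr (_ + _).
  apply: big1_seq => j; rewrite mem_index_iota => /andP[_ /andP[_ jr]].
  rewrite S0 (A0_homog _ _ _ LK_mulrn_inj) ?e ?(gtn_eqF jr) // mulr0.
  suff -> : iter j.-1 theta 0 = 0 by rewrite mulr0.
  by elim: j.-1 => //= i ->; exact: theta0.
have f0 : ((r.+1)`!%:R : LK) != 0 by rewrite -(prednK (fact_gt0 r.+1)) LK_nat_neq0.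
apply: (mulfI f0); rewrite mulrA mulfV // mul1r [RHS]mulr_natl.
rewrite (lagrange_inversion ddy_derivation (mulfV yL_neq0) half2 ddy_yL ddy_vL
  ddy_vLV ddy_half Yy YE e).
rewrite iter_thsE S0 [r.+1.-1]/=; congr (iter r theta _).
rewrite mulrC -tpsC1 -tpsCD mulrC [in RHS]mulrC tpsCM; congr (_ * _).
by rewrite mulrDl mul1r mulfV ?yL_neq0 // addrC.
Qed.

Local Notation ng := (@tps_map n d LK negy).

Lemma ngD f g : ng (f + g) = ng f + ng g.
Proof. exact: tps_map_morD negyD f g. Qed.
Lemma ngM f g : ng (f * g) = ng f * ng g.
Proof. exact: tps_map_morM negyD negyM f g. Qed.
Lemma negy0 : negy 0 = 0.
Proof. by apply: (addrI (negy 0)); rewrite -negyD !addr0. Qed.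
Lemma ng0 : ng 0 = 0.
Proof. by apply: (addrI (ng 0)); rewrite -ngD !addr0. Qed.
Lemma ngN f : ng (- f) = - ng f.
Proof. by apply: (addrI (ng f)); rewrite -ngD !subrr ng0. Qed.
Lemma ngC x : ng (C x) = C (negy x).
Proof.
by apply/ffunP => m; rewrite tps_mapE !tpsCE; case: eqP; rewrite ?mulr0n ?negy0.
Qed.
Lemma ngX f i : ng (f ^+ i) = ng f ^+ i.
Proof.
elim: i => [|i IH]; first by rewrite !expr0 -tpsC1 ngC negy1.
by rewrite !exprS ngM IH.
Qed.
Lemma ng_cvar k : ng (cvar n d LK k) = cvar n d LK k.
Proof.
apply/ffunP => m; rewrite tps_mapE /cvar; case: insubP => [j _ _|_].
  by rewrite ffunE; case: eqP; rewrite ?negy1 ?negy0.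
by rewrite tps0 negy0.
Qed.

Lemma ng_A x : ng (A x) = A (ng x).
Proof.
rewrite /Afun (big_morph ng ngD ng0); apply: eq_bigr => k _.
rewrite !ngM ng_cvar !ngX ngD -tpsC1 !ngC negy1 negy_vL.
by rewrite (negyV vL_neq0 negy_vL).
Qed.

Lemma fil_ng k f : fil k f -> fil k (ng f).
Proof. by move=> h m hm; rewrite tps_mapE h // negy0. Qed.

Lemma tps_of_U : tps_of n d User = C 2%:R^-1 * (tps_of n d Tser - ng (tps_of n d Tser)).
Proof.
by apply/ffunP => m; rewrite tps_ofE tpsCM tpsB tps_mapE !tps_ofE /User mulrC.
Qed.

Lemma tps_of_eps : tps_of n d epsser = tps_of n d User * C yL^-1 - 1.
Proof.
by apply/ffunP => m; rewrite tps_ofE tpsB mulrC tpsCM tps1 tps_ofE /epsser expo_seq_eq0 mulrC.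
Qed.

Lemma tps_of_neg f : tps_of n d (smap (fun x => - x) f) = - tps_of n d f.
Proof. by apply/ffunP => m; rewrite tpsN !tps_ofE. Qed.

(** The cut-off of [psum0] varies with the monomial; the extra terms of the uniform sum have order
    above its degree. *)
Lemma tps_of_inv_sum : fil 1 (tps_of n d epsser) ->
  tps_of n d inv1peps = \sum_(k < (n * d.+1).+1) (- tps_of n d epsser) ^+ k.
Proof.
move/filN => he; apply/ffunP => m; rewrite tps_ofE tps_sum /inv1peps /psum0 size_expo_seq.
set e := - tps_of _ _ _ in he *; rewrite -(big_mkord xpredT (fun k => (e ^+ k) m)).
have hm : ((exdeg m).+1 <= (n * d.+1).+1)%N by rewrite ltnS exdeg_max.
rewrite (@big_cat_nat _ _ _ _ _ _ _ _ (leq0n _) hm) /=.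
rewrite [X in _ = _ + X]big_nat_cond [X in _ = _ + X]big1 ?addr0 => [|k]; last first.
  rewrite andbT => /andP[mk _].
  have : fil k (e ^+ k) by rewrite -[X in fil X _]muln1; exact: filX.
  exact.
by apply: eq_bigr => k _; rewrite -tps_ofE tps_of_pow tps_of_neg.
Qed.

Lemma tps_of_inv : fil 1 (tps_of n d epsser) ->
  (1 + tps_of n d epsser) * tps_of n d inv1peps = 1.
Proof.
move=> he; rewrite tps_of_inv_sum //; move/filN: he => /fil_nil.
set e := tps_of _ _ _ => he; have := subrX1 (- e) (n * d.+1).+1; rewrite he => eq.
apply: oppr_inj; rewrite -[- 1]add0r eq -mulNr; congr (_ * _).
by rewrite opprD addrC.
Qed.

Lemma tps_of_Xneg N : tps_of n d (Xneg N) = (tps_of n d inv1peps * C yL^-1) ^+ N.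
Proof.
apply/ffunP => m; rewrite tps_ofE /Xneg /smap exprMn tpsCX.
by rewrite (mulrC _ (C _)) tpsCM -tps_of_pow tps_ofE exprVn.
Qed.
End Series.

Lemma tps_coef0M n d (f g : tps n d LK) :
  (f * g) (ex0 n d) = f (ex0 n d) * g (ex0 n d).
Proof.
rewrite tpsM (bigD1 (ex0 n d)) ?exle0 //= exsub0 big1 ?addr0 // => k /andP[/exleP k0 /eqP []].
by apply: expoP => i; apply/eqP; have := k0 i; rewrite !ex0E leqn0.
Qed.

Lemma fil1_coef0 n d (f g : tps n d LK) : fil 1 (f - g) -> f (ex0 n d) = g (ex0 n d).
Proof.
by move/(_ (ex0 n d)); rewrite exdeg0 tpsB => /(_ isT)/eqP; rewrite subr_eq0 => /eqP.
Qed.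

Lemma binomial_ratio N : (0 < N)%N ->
  ((N * 'C((2 * N).+1, N))%:R : rat) = ((2 * N).+1)`!%:R / ((N.-1)`! * (N.+1)`!)%:R.
Proof.
move=> N0; apply: (canRL (mulfK _)); first by rewrite pnatr_eq0 -lt0n muln_gt0 !fact_gt0.
rewrite -natrM; congr (_%:R).
have := @bin_fact (2 * N).+1 N; rewrite (_ : (2 * N).+1 - N = N.+1)%N; last by lia.
have -> : N`! = (N * N.-1`!)%N by rewrite -{1}(prednK N0) factS prednK.
by move=> <-; [rewrite -!mulnA mulnCA|lia].
Qed.

Section HalfSum.
Variables (R : comNzRingType) (h y Y Y' : R).
Hypothesis h2 : h * 2%:R = 1.
Let s := h * (2%:R + Y + Y').
Let e := h * (Y - Y').

(** The even terms y^2 cancel, and Y - Y' factors out of the rest. *)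
Lemma half_mul : h * ((Y + h * Y ^+ 2 - h * y ^+ 2) - (Y' + h * Y' ^+ 2 - h * y ^+ 2)) = s * e.
Proof.
transitivity (h * (h * 2%:R) * (Y - Y') + h * h * (Y ^+ 2 - Y' ^+ 2)); last by rewrite /s /e; ring.
by rewrite h2; ring.
Qed.

Lemma half_add : s + e - 1 = Y.
Proof. by transitivity ((h * 2%:R) * (1 + Y) - 1); [rewrite /s /e; ring|rewrite h2; ring]. Qed.

Lemma half_sub : s - e - 1 = Y'.
Proof. by transitivity ((h * 2%:R) * (1 + Y') - 1); [rewrite /s /e; ring|rewrite h2; ring]. Qed.

Lemma half_s : s - 1 = h * ((Y - y) + (Y' + y)).
Proof. by transitivity (h * 2%:R - 1 + h * (Y + Y')); [rewrite /s; ring|rewrite h2; ring]. Qed.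

Lemma half_e : e - y = h * ((Y - y) - (Y' + y)).
Proof. by transitivity (h * (Y - Y') - (h * 2%:R) * y); [rewrite /e h2; ring|ring]. Qed.
End HalfSum.

Lemma quad_shift (R : comNzRingType) (x Y y v vi A : R) (P : R -> R) :
  x - 1 = Y -> Y ^+ 2 = y ^+ 2 + 2%:R * A -> A = vi * P (v * (1 + Y) ^+ 2) ->
  (x - 1) ^+ 2 = y ^+ 2 + 2%:R * vi * P (v * x ^+ 2).
Proof. by move=> <- -> ->; rewrite mulrA [1 + _]addrC subrK. Qed.

Lemma dlog_value (F : fieldType) (v y : F) : v != 0 -> y != 0 ->
  v^-1 * (v * y ^+ 2)^-1 * (v * (v * (y *+ 2))) = y^-1 *+ 2.
Proof. by move=> v0 y0; field; rewrite v0 y0. Qed.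

(** At c = 0 one has a = v and b = v y^2, so [a,b]/(a b) is 2 v^2 y/(v^2 y^2). *)
Lemma dlog_coef0 n d (y v s e ai bi : tps n d LK) :
  y (ex0 n d) = yL -> v (ex0 n d) = vL -> fil 1 (s - 1) -> fil 1 (e - y) ->
  v * s ^+ 2 * ai = 1 -> v * e ^+ 2 * bi = 1 ->
  (ai * bi * bracket (tps_map GL) (tps_map ddy) (v * s ^+ 2) (v * e ^+ 2)) (ex0 n d)
  = yL^-1 *+ 2.
Proof.
move=> y0 v0 fs fe aai bbi.
have one0 : (1 : tps n d LK) (ex0 n d) = 1 by rewrite tps1 eqxx.
have s0 : s (ex0 n d) = 1 by rewrite (fil1_coef0 fs).
have e0 : e (ex0 n d) = yL by rewrite (fil1_coef0 fe).
have a0 : (v * s ^+ 2) (ex0 n d) = vL by rewrite !tps_coef0M s0 v0 !mulr1.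
have b0 : (v * e ^+ 2) (ex0 n d) = vL * yL ^+ 2 by rewrite !tps_coef0M e0 v0.
have ai0 : ai (ex0 n d) = vL^-1.
  have := congr1 (fun f : tps n d LK => f (ex0 n d)) aai.
  by rewrite /= tps_coef0M a0 one0 => /mulr1_eq.
have bi0 : bi (ex0 n d) = (vL * yL ^+ 2)^-1.
  have := congr1 (fun f : tps n d LK => f (ex0 n d)) bbi.
  by rewrite /= tps_coef0M b0 one0 => /mulr1_eq.
rewrite tps_coef0M (tps_coef0M ai) ai0 bi0 /bracket tpsB.
rewrite (tps_coef0M (tps_map GL (v * s ^+ 2))) (tps_coef0M (tps_map GL (v * e ^+ 2))).
rewrite !tps_mapE a0 b0 GL_vL ddy_vL mulr0 subr0.
rewrite (derM ddy_derivation) ddy_vL mul0r add0r (derX ddy_derivation) ddy_yL mulr1 expr1.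
exact: dlog_value vL_neq0 yL_neq0.
Qed.

(** * The residue of the negative power and the conclusion *)

Section Final.
Variables n d : nat.
Local Notation R := (tps n d LK).
Local Notation C := (@tpsC n d LK).
Local Notation c := (cvar n d LK).

Lemma residue_Xneg N (m : expo n d) : (0 < N)%N -> ~~ odd N -> (N < n)%N ->
  hres ((C yL * C vL * (C vL^-1 * (tps_of n d inv1peps * C yL^-1)) ^+ N) m)
    (if expo_seq m == [:: N] then - (((2 * N).+1)`!%:R / ((N.-1)`! * (N.+1)`!)%:R) else 0).
Proof.
move=> N0 Nodd Nn.
have [Y [Yy YE lY]] := Afun_solution n d (mulfV yL_neq0) half2 laur0 laur1 laurN laurD
  laurM laur_yL laur_yLV laur_vL laur_vLV (laur_invn 1).
have TE := tps_of_T Yy YE.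
have AE (x : R) : Afun vL vL^-1 x = C vL^-1 * \sum_(k < n) c k * (C vL * (1 + x) ^+ 2) ^+ k.
  rewrite big_distrr; apply: eq_bigr => k _ /=; rewrite (exprMn _ (C vL)) -exprM.
  by move: (C vL ^+ k) (C vL^-1) (_ ^+ (2 * k)) => v' vi' x'; ring.
have yyi' : C yL * C yL^-1 = 1 := tpsC_inv n d (mulfV yL_neq0).
have vvi : C vL * C vL^-1 = 1 := tpsC_inv n d (mulfV vL_neq0).
have ngy : tps_map negy (C yL) = - C yL.
  by rewrite -tpsCN; exact: etrans (ngC n d _) (congr1 C negy_yL).
have ng2 : tps_map negy (2%:R : R) = 2%:R.
  by rewrite -tpsC_nat ngC (mulrSr 1 1) negyD negy1.
have ngh : tps_map negy (C 2%:R^-1) = C 2%:R^-1 := etrans (ngC n d _) (congr1 C negy_half).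
have lC := laursC (n := n) (d := d) laur0.
have lh : laurs laur (C 2%:R^-1) by apply: (lC _); exact: laur_invn.
have lyi : laurs laur (C yL^-1) by apply: (lC _); exact: laur_yLV.
have lv : laurs laur (C vL) by apply: (lC _); exact: laur_vL.
have lvi : laurs laur (C vL^-1) by apply: (lC _); exact: laur_vLV.
have l1 : laurs laur (1 : R) by apply: (lC _); exact: laur1.
have Gv : tps_map GL (C vL) = C vL.
  exact: etrans (tps_map_C n d vL GL_derivation) (congr1 C GL_vL).
have dv : tps_map ddy (C vL) = 0.
  exact: etrans (tps_map_C n d vL ddy_derivation) (etrans (congr1 C ddy_vL) (tpsC_nat n d LK 0)).
have dy1 : tps_map ddy (C yL) = 1.
  exact: etrans (tps_map_C n d yL ddy_derivation) (congr1 C ddy_yL).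
have y0 : C yL (ex0 n d) = yL by rewrite tpsCE eqxx.
have v0 : C vL (ex0 n d) = vL by rewrite tpsCE eqxx.
have epsE := tps_of_eps n d.
have UE0 := tps_of_U n d.
have tpsC_half : C 2%:R^-1 * 2%:R = 1 := tpsC_half n d half2.
move: (C yL) (C yL^-1) (C vL) (C vL^-1) (C 2%:R^-1) Yy YE TE AE yyi' vvi ngy ngh lh lyi lv lvi
  Gv dv dy1 y0 v0 epsE UE0 tpsC_half.
move=> y yi v vi h Yy YE TE AE yyi' vvi ngy ngh lh lyi lv lvi Gv dv dy1 y0 v0 epsE0 UE0 tpsC_half.
(* The equation of [Y] is even in y, so Y(-y) solves it too, now with leading term -y. *)
pose Y' := tps_map negy Y.
have Y'y : fil 1 (Y' + y).
  rewrite (_ : Y' + y = tps_map negy (Y - y)); first exact: fil_ng.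
  by rewrite ngD ngN ngy opprK.
have Y'E : Y' ^+ 2 = y ^+ 2 + 2%:R * Afun vL vL^-1 Y'.
  have := congr1 (tps_map negy) YE.
  rewrite (ngX Y 2).
  rewrite (ngD (y ^+ 2)).
  rewrite (ngM 2%:R).
  rewrite (ngX y 2).
  rewrite ng2.
  rewrite ngy.
  rewrite ng_A.
  rewrite (sqrrN y).
  exact.
pose s := h * (2%:R + Y + Y'); pose e := h * (Y - Y').
have UE : tps_of n d User = s * e.
  rewrite UE0 TE !ngD !ngN (ngM h (Y ^+ 2)) (ngM h (y ^+ 2)) (ngX Y 2) (ngX y 2).
  by rewrite ngy sqrrN ngh; exact: half_mul.
have es1 : s + e - 1 = Y by exact: half_add.
have es2 : s - e - 1 = Y' by exact: half_sub.
have fs : fil 1 (s - 1).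
  by rewrite /s (half_s y Y Y' tpsC_half); apply: filMl; exact: filD.
have fe : fil 1 (e - y).
  by rewrite /e (half_e y Y Y' tpsC_half); apply: filMl; apply: filD => //; exact: filN.
have epsE : tps_of n d epsser = s * e * yi - 1 by rewrite epsE0 UE.
have feps : fil 1 (tps_of n d epsser).
  have -> : tps_of n d epsser = ((s - 1) * e + (e - y)) * yi.
    rewrite epsE; transitivity (s * e * yi - y * yi); first by rewrite yyi'.
    by move: (s) (e) (y) (yi) => s' e' y' yi'; ring.
  by rewrite mulrC; apply: filMl; apply: filD => //; rewrite mulrC; exact: filMl.
pose inv := tps_of n d inv1peps; rewrite -/inv.
(* [I] is X^-1 = y^-1 (1 + eps)^-1. *)
pose I := inv * yi; rewrite -/I.
have Ise : I * s * e = 1.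
  rewrite -(tps_of_inv feps) -/inv epsE /I.
  by move: (s) (e) (inv) (yi) => s' e' i' yi'; ring.
have lY' : laurs laur Y'.
  move=> k; rewrite tps_mapE; exact: laur_negy.
have lD := laursD (n := n) (d := d) laurD.
have lN := laursN (n := n) (d := d) laurN.
have lM := laursM (n := n) (d := d) laur0 laurD laurM.
clearbody Y'.
have ls : laurs laur s.
  apply: (lM _ _) => //; apply: (lD _ _) => //; apply: (lD _ _) => //.
  by rewrite (mulrSr 1 1); exact: (lD _ _).
have le : laurs laur e by apply: (lM _ _) => //; apply: (lD _ _) => //; exact: (lN _).
clearbody s e.
have lI : laurs laur I.
  apply: (lM _ _) => //; rewrite /inv tps_of_inv_sum //.
  apply: laurs_sum; [exact: laur0|exact: laurD|move=> k].
  apply: laursX; [exact: laur0|exact: laur1|exact: laurD|exact: laurM|].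
  apply: (lN _); rewrite epsE.
  by apply: (lD _ _); [apply: (lM _ _) => //; exact: (lM _ _)|exact: (lN _)].
pose Zero (f : R) := forall m, hres (f m) 0.
have ZeroD (f g : R) : Zero f -> Zero g -> Zero (f + g).
  by move=> hf hg k; rewrite tpsD -(addr0 0); exact: hresD.
have ZeroN (f : R) : Zero f -> Zero (- f).
  by move=> hf k; rewrite tpsN -oppr0; exact: hresN.
have ZeroMn (f : R) i : Zero (f *+ i.+1) -> Zero f.
  by move=> hf k; rewrite -(mul0r (i.+1%:R^-1)); apply: hres_divn; rewrite -tpsMn.
have ZeroG (f : R) : laurs laur f -> Zero (tps_map GL f).
  by move=> hf k; rewrite tps_mapE; exact: hres_GL.
have Zerody (f : R) : laurs laur f -> Zero (tps_map ddy f).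
  by move=> hf k; rewrite tps_mapE; exact: hres_ddy.
have Zeroc k (f : R) : Zero f -> Zero (c k * f).
  move=> hf l; rewrite /cvar; case: insubP => [j _ _|_]; last by rewrite mul0r tps0; exact: hres0.
  by rewrite tps_monM; case: ifP => _; [rewrite mul1r|exact: hres0].
have nilc (f : nat -> R) : exists K, (\sum_(k < n) c k * f k) ^+ K = 0.
  exists (n * d.+1).+1; apply: fil_nil; apply: fil_sum => k _; rewrite mulrC.
  by apply: filMl; exact: fil_cvar.
have Gdy (f : R) : tps_map GL (tps_map ddy f) = tps_map ddy (tps_map GL f).
  by apply/ffunP => k; rewrite !tps_mapE GL_ddy.
pose Pf z := \sum_(k < n) c k * z ^+ k.
have Hp : (s + e - 1) ^+ 2 = y ^+ 2 + 2%:R * vi * Pf (v * (s + e) ^+ 2).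
  exact: (quad_shift (P := Pf) es1 YE (AE Y)).
have Hq : (s - e - 1) ^+ 2 = y ^+ 2 + 2%:R * vi * Pf (v * (s - e) ^+ 2).
  exact: (quad_shift (P := Pf) es2 Y'E (AE Y')).
have q44 : h * h * 4%:R = 1.
  transitivity ((h * 2%:R) * (h * 2%:R)); last by rewrite tpsC_half mulr1.
  by move: (h) => h'; ring.
have laurGL' (f : R) : laurs laur f -> laurs laur (tps_map GL f).
  by apply: laurs_map; exact: laur_GL.
have laurddy' (f : R) : laurs laur f -> laurs laur (tps_map ddy f).
  by apply: laurs_map; exact: laur_ddy.
have laurE' (f : R) : laurs laur f -> laurs laur (euler f).
  by apply: laurs_euler; [exact: laur0|exact: laurD].
have lc k : laurs laur (c k) by apply: laurs_cvar; [exact: laur0|exact: laur1].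
have NM : N = (2 * N./2)%N by rewrite mul2n -[LHS]odd_double_half (negbTE Nodd).
have M0 : (0 < N./2)%N by move: N0; rewrite {1}NM muln_gt0.
have Mn : (2 * N./2 < n)%N by rewrite -NM.
have [ai [bi]] := @residue_core R _ _ _
  (tps_map_derivation n d GL_derivation) (tps_map_derivation n d ddy_derivation)
  (euler_derivation n d LK) Gdy (fun f => euler_map f GL_derivation)
  (fun f => euler_map f ddy_derivation) _ _
  l1 lD lN lM laurGL' laurddy' laurE' ZeroD ZeroN ZeroMn ZeroG Zerody
  n N./2 c y v vi s e I (h * h)
  (fun k => tps_map_cvar n d k GL_derivation) (fun k => tps_map_cvar n d k ddy_derivation)
  Zeroc nilc lv lvi ls le lI (lM _ _ lh lh) lc vvi Ise q44 Gv dv dy1 Hp Hq M0 Mn.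
rewrite -NM; set w := ai * bi * _; case=> aai bbi ZEw Zt.
have w0 : w (ex0 n d) = yL^-1 *+ 2 by exact: dlog_coef0 y0 v0 fs fe aai bbi.
clearbody w.
(* In positive degree j the vanishing residue of [euler w] is j times that of [w], so only the
   constant term 2/y contributes. *)
have hw k : hres (w k) (if k == ex0 n d then 2%:R else 0).
  case: eqP => [->|/eqP k0]; first by rewrite w0; apply: hres_natmul; exact: hres_yV.
  have := ZEw k; rewrite eulerE; case ek: (exdeg k) => [|j].
    by move/eqP: ek; rewrite exdeg_eq0 (negbTE k0).
  by move/hres_divn; rewrite mul0r.
have hcw : hres ((c N * w) m) (if expo_seq m == [:: N] then 2%:R else 0).
  have ev : seq_expo n d [:: N] = exvar d (Ordinal Nn).
    by apply: expoP => i; rewrite !ffunE /= addn0 eq_sym.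
  rewrite expo_seq_single Nn andbT ev /cvar insubT tps_monM mul1r.
  have [->|ne] := eqVneq m (exvar d (Ordinal Nn)).
    case: ifP => [_|/exleP []//]; have := hw (exsub (exvar d (Ordinal Nn)) (exvar d (Ordinal Nn))).
    by rewrite ifT //; apply/eqP/expoP => i; rewrite exsubE ex0E subnn.
  case: ifP => [le_m|_]; last exact: hres0.
  have := hw (exsub m (exvar d (Ordinal Nn))); rewrite ifN //.
  apply: contra ne => /eqP e0; rewrite -(exsubK le_m) e0 exsub0.
  by [].
set t := y * v * _ in Zt *; set K := (N * _)%N in Zt.
clearbody t.
(* The 2 in front of [t], from [v,W]/v = -2 y v, will cancel the residue 2 of dlog a dlog b, leaving
   -K. *)
have ht : hres (t m *+ 2) (0 - (if expo_seq m == [:: N] then 2%:R else 0) *+ K).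
  have -> : t m *+ 2 = (2%:R * t + c N * w *+ K) m - (c N * w) m *+ K.
    by rewrite tpsD tpsMn addrK mulr_natl tpsMn.
  by apply: hresD; [exact: Zt|apply: hresN; exact: hres_natmul].
have := hres_divn ht; congr hres; case: ifP => _; last by rewrite mul0rn subr0 mul0r.
rewrite -binomial_ratio // -/K sub0r mulNr -[2%:R *+ K]mulr_natr mulrAC mulfV //.
by rewrite mul1r.
Qed.
End Final.

Unset Implicit Arguments.

(* For every positive even N and every monomial mu in the c's (sorted list of
   indices), the coefficient of c^mu in [v^{N-1} y^{-2}] X^{-N} is
   -(2N+1)!/((N-1)!(N+1)!) if mu = c_N, and 0 otherwise. *)
Theorem theorem1 (N : nat) (hN : (0 < N)%N) (hev : ~~ odd N)
    (mu : seq nat) (hmu : sorted leq mu) :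
  has_lcoef (Xneg N mu) (N%:Z - 1) (-2)
    (if mu == [:: N] then - (((2 * N).+1)`!%:R / ((N.-1)`! * (N.+1)`!)%:R)
     else 0).
Proof.
(* [n] exceeds [N] and all indices in [mu], and no multiplicity in [mu] exceeds [d], so the
   truncation loses nothing at this monomial. *)
pose n := (\max_(a <- mu) a + N).+1; pose d := size mu.
have mu_n a : a \in mu -> (a < n)%N.
  move=> amu; rewrite /n ltnS; apply: leq_trans (leq_addr _ _).
  exact: (@leq_bigmax_seq _ mu xpredT id).
have lmu : expo_seq (seq_expo n d mu) = mu by apply: seq_expoK.
apply: hres_lcoef => //.
have := @residue_Xneg n d N (seq_expo n d mu) hN hev; rewrite lmu => /(_ _).
rewrite exprMn -tps_of_Xneg; move/(_ (leq_addl _ _)).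
by rewrite tpsCX !tpsC_mul mulrA tpsC_mul tpsCM tps_ofE lmu.
Qed.
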